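(* Let $\tau$ be a vocabulary consisting of one binary relation symbol and a countably infinite set of unary relation symbols. Then both the satisfiability problem and the finite satisfiability problem of $\exists^3\forall[A_{\mathit{5\text{-}inc}}](\tau)$ are undecidable.
   Context: Team semantics (lax): structures have nonempty domains; an assignment is $s:D\to A$, $D$ a finite set of variables; a team $X$ is a set of assignments with common domain and codomain $A$; $\mathrm{rel}(X,(y_1,\dots,y_m))=\{(s(y_1),\dots,s(y_m)):s\in X\}$. Formulas in negation normal form (literals, $\wedge,\vee,\exists,\forall$) plus generalized atoms; literal holds in $X$ iff all $s\in X$ satisfy it; $\wedge$ componentwise; $\psi\vee\vartheta$ holds in $X$ iff $X=Y\cup Z$, $Y\models\psi$, $Z\models\vartheta$; $\exists x\psi$ holds in $X$ iff $\psi$ holds in $\{s[a/x]:s\in X,a\in F(s)\}$ for some $F:X\to\mathcal P(A)\setminus\{\emptyset\}$; $\forall x\psi$ holds in $X$ iff $\psi$ holds in $\{s[a/x]:s\in X,a\in A\}$; a sentence is true in $\mathfrak A$ iff it holds in $\{\emptyset\}$. $A_{\mathit{5\text{-}inc}}$ is the generalized atom of type $(5,5)$ with $\mathfrak A\models_X A_{\mathit{5\text{-}inc}}(\bar y,\bar z)$ iff $\mathrm{rel}(X,\bar y)\subseteq\mathrm{rel}(X,\bar z)$ (the 5-ary inclusion atom). $\exists^3\forall[A_{\mathit{5\text{-}inc}}](\tau)$: sentences over $\tau$ of the form $\exists x_1\exists x_2\exists x_3\forall y\,\theta$ with $\theta$ quantifier-free, possibly containing $A_{\mathit{5\text{-}inc}}$-atoms.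 (Finite) satisfiability: decide whether a given sentence has a (finite) model. *)

(* Defs.v *)
From mathcomp Require Import all_boot finmap.
From mathcomp Require Import boolp classical_sets cardinality.

Set Implicit Arguments.
Unset Strict Implicit.
Unset Printing Implicit Defensive.

Local Open Scope classical_set_scope.
Local Open Scope fmap_scope.

Record vocabulary := Vocabulary { sym :> Type; arity : sym -> nat }.

Record structure (tau : vocabulary) := Structure {
  dom :> Type;
  dom_nonempty : inhabited dom;
  interp : forall R : tau, (arity R).-tuple dom -> Prop }.

Definition var := nat.

Inductive formula (tau : vocabulary) : Type :=
| Eq of var & var
| Neq of var & var
| Rel (R : tau) of (arity R).-tuple var
| NRel (R : tau) of (arity R).-tuple var
| Inc5 of 5.-tuple var & 5.-tuple var
| And of formula tau & formula tau
| Or of formula tau & formula tau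
| Ex of var & formula tau
| All of var & formula tau.

Arguments Eq {tau} _ _.
Arguments Neq {tau} _ _.
Arguments Inc5 {tau} _ _.

Fixpoint quantifier_free (tau : vocabulary) (phi : formula tau) : bool :=
  match phi with
  | And psi theta | Or psi theta => quantifier_free psi && quantifier_free theta
  | Ex _ _ | All _ _ => false
  | _ => true
  end.

Fixpoint free_vars (tau : vocabulary) (phi : formula tau) : seq var :=
  match phi with
  | Eq x y | Neq x y => [:: x; y]
  | Rel _ xs | NRel _ xs => xs
  | Inc5 ys zs => ys ++ zs
  | And psi theta | Or psi theta => free_vars psi ++ free_vars theta
  | Ex x psi | All x psi => [seq z <- free_vars psi | z != x]
  end.

Definition sentence (tau : vocabulary) (phi : formula tau) : Prop :=
  free_vars phi = [::].

Definition E3A_sentence (tau : vocabulary) (phi : formula tau) : Prop :=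
  sentence phi /\
  exists (x1 x2 x3 y : var) (theta : formula tau),
    [/\ uniq [:: x1; x2; x3; y], quantifier_free theta &
        phi = Ex x1 (Ex x2 (Ex x3 (All y theta)))].

(* An assignment is a function from a finite set of variables to A.  The sets
   of assignments reached when evaluating a formula from {emptyset} always have
   a common domain, so this condition on teams is not recorded in the type. *)
Definition assignment (A : Type) := {fmap var -> A}.
Definition team (A : Type) := set (assignment A).

Definition values (A : Type) (s : assignment A) (m : nat)
    (ys : m.-tuple var) (a : m.-tuple A) : Prop :=
  forall i : 'I_m, s.[? tnth ys i] = Some (tnth a i).

Definition rel_of (A : Type) (X : team A) (m : nat) (ys : m.-tuple var) :
    set (m.-tuple A) :=
  [set a | exists2 s, X s & values s ys a].

Definition supplement (A : Type) (X : team A) (F : assignment A -> set A)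
    (x : var) : team A :=
  [set t | exists s a, [/\ X s, F s a & t = s.[x <- a]]].

Fixpoint holds (tau : vocabulary) (M : structure tau) (X : team M)
    (phi : formula tau) : Prop :=
  match phi with
  | Eq x y => forall s, X s ->
      exists a b : M, [/\ s.[? x] = Some a, s.[? y] = Some b & a = b]
  | Neq x y => forall s, X s ->
      exists a b : M, [/\ s.[? x] = Some a, s.[? y] = Some b & a <> b]
  | Rel R xs => forall s, X s -> exists2 a, values s xs a & interp a
  | NRel R xs => forall s, X s -> exists2 a, values s xs a & ~ interp a
  | Inc5 ys zs => rel_of X ys `<=` rel_of X zs
  | And psi theta => holds X psi /\ holds X theta
  | Or psi theta => exists Y Z : team M,
      [/\ X = Y `|` Z, holds Y psi & holds Z theta]
  | Ex x psi => exists F : assignment M -> set M,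
      (forall s, X s -> F s !=set0) /\ holds (supplement X F x) psi
  | All x psi => holds (supplement X (fun=> setT) x) psi
  end.

Definition true_in (tau : vocabulary) (M : structure tau) (phi : formula tau) :
    Prop :=
  holds [set [fmap] : assignment M] phi.

Definition satisfiable (tau : vocabulary) (phi : formula tau) : Prop :=
  exists M : structure tau, true_in M phi.

Definition finitely_satisfiable (tau : vocabulary) (phi : formula tau) : Prop :=
  exists M : structure tau, finite_set [set: M] /\ true_in M phi.

Inductive tau_sym := Bin | Un of nat.

Definition tau_bin_un : vocabulary :=
  Vocabulary (fun R : tau_sym => if R is Bin then 2 else 1).

(* Partial recursive functions, with their arities; [sem f v r] means that f is
   defined at v, with value r. *)
Inductive recf : nat -> Type :=
| Zero n : recf n
| Succ : recf 1
| Proj n of 'I_n : recf n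
| Comp n m of recf m & ('I_m -> recf n) : recf n
| PrimRec n of recf n & recf n.+2 : recf n.+1
| Mu n of recf n.+1 : recf n.

Fixpoint sem (n : nat) (f : recf n) : n.-tuple nat -> nat -> Prop :=
  match f in recf n return n.-tuple nat -> nat -> Prop with
  | Zero _ => fun _ r => r = 0
  | Succ => fun v r => r = (thead v).+1
  | Proj _ i => fun v r => r = tnth v i
  | @Comp _ m f g => fun v r =>
      exists2 w : m.-tuple nat, (forall i, sem (g i) v (tnth w i)) & sem f w r
  | @PrimRec n f g => fun v r =>
      let p : n.-tuple nat := [tuple of behead v] in
      (fix iter k r := match k with
        | 0 => sem f p r
        | k.+1 => exists2 q, iter k q & sem g [tuple of k :: q :: p] r
        end) (thead v) r
  | Mu _ f => fun v r =>
      sem f [tuple of r :: v] 0 /\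
      forall k, k < r -> exists q, sem f [tuple of k :: v] q.+1
  end.

(* The decision problem "given x in D, does P x hold?", for inputs presented
   through the numbering enc. *)
Definition decidable_problem (T : Type) (enc : T -> nat) (D P : T -> Prop) :
    Prop :=
  exists f : recf 1, forall x, D x ->
    (P x /\ sem f [tuple enc x] 1) \/ (~ P x /\ sem f [tuple enc x] 0).

Definition sym_code (R : tau_sym) : nat := if R is Un i then i.+1 else 0.

(* CodeSeq.code is a bijection from finite sequences of naturals to naturals. *)
Fixpoint formula_code (phi : formula tau_bin_un) : nat :=
  match phi with
  | Eq x y => CodeSeq.code [:: 0; x; y]
  | Neq x y => CodeSeq.code [:: 1; x; y]
  | Rel R xs => CodeSeq.code [:: 2, sym_code R & xs]
  | NRel R xs => CodeSeq.code [:: 3, sym_code R & xs]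
  | Inc5 ys zs => CodeSeq.code (4 :: ys ++ zs)
  | And psi theta => CodeSeq.code [:: 5; formula_code psi; formula_code theta]
  | Or psi theta => CodeSeq.code [:: 6; formula_code psi; formula_code theta]
  | Ex x psi => CodeSeq.code [:: 7; x; formula_code psi]
  | All x psi => CodeSeq.code [:: 8; x; formula_code psi]
  end.

Lemma sym_code_inj : injective sym_code.
Proof. by move=> [|i] [|j] //= [->]. Qed.

Lemma formula_code_inj : injective formula_code.
Proof.
elim=> [x y|x y|R xs|R xs|ys zs|a IHa b IHb|a IHa b IHb|x a IHa|x a IHa]
  [x' y'|x' y'|R' xs'|R' xs'|ys' zs'|a' b'|a' b'|x' a'|x' a'] eq_code;
  have := can_inj CodeSeq.codeK eq_code => {eq_code} // -[].
- by move=> -> ->.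
- by move=> -> ->.
- by move=> /sym_code_inj eqR; case: _ / eqR xs' => xs' /val_inj ->.
- by move=> /sym_code_inj eqR; case: _ / eqR xs' => xs' /val_inj ->.
- move=> /eqP; rewrite eqseq_cat ?size_tuple // => /andP[/eqP eqy /eqP eqz].
  by rewrite (val_inj eqy) (val_inj eqz).
- by move=> /IHa -> /IHb ->.
- by move=> /IHa -> /IHb ->.
- by move=> -> /IHa ->.
- by move=> -> /IHa ->.
Qed.

(* Main.v *)
From HB Require Import structures.
Require Import Defs.
From Stdlib Require Import Relation_Operators Operators_Properties.
From mathcomp Require Import all_boot finmap zify.
From mathcomp Require Import boolp classical_sets cardinality.

(** A history machine repeatedly appends a node to its own history.  A node
    carries a label, a tag, its predecessor and a pointer to an older node; the
    new pointer is obtained from the last node by at most two dereferences.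
    Reading the pointer of the latest node with a given tag as the content of a
    register, and a node as the length of its chain of pointers, such a machine
    simulates while programs, hence all partial recursive functions.

    A history is a structure over one binary and finitely many unary symbols: the
    pointers are the edges that are not symmetric, the predecessors the symmetric
    ones along which the length drops by one modulo 3.  In the team of a sentence
    Ex 0 Ex 1 Ex 2 All 3, variable 0 is a node, 1 its pointer, 2 the next node or
    the first one, so that the inclusion of the values of 2 in those of 0 makes
    every model contain the whole run.  If the run meets the forbidden label there
    is no model, and if it halts its history is a finite model.

    Only the input has to be compiled computably: if e is the code of the
    formula describing a program for "run the supposed decider on the sentence
    obtained from the formula coded by e and the input e", then the decider is
    wrong on the sentence obtained from e. *)

Set Implicit Arguments.
Unset Strict Implicit.
Unset Printing Implicit Defensive.

Local Open Scope classical_set_scope.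
Local Open Scope fmap_scope.

Definition update (A : Type) (f : nat -> A) (x : nat) (a : A) : nat -> A :=
  fun z => if z == x then a else f z.

Lemma update_same (A : Type) (f : nat -> A) x a : update f x a x = a.
Proof. by rewrite /update eqxx. Qed.

Lemma update_other (A : Type) (f : nat -> A) x a z : z <> x -> update f x a z = f z.
Proof. by rewrite /update; case: eqP. Qed.

(** * Flatness of first-order formulas *)

Section FirstOrder.
Variable tau : vocabulary.

Fixpoint first_order (phi : formula tau) : bool :=
  match phi with
  | Inc5 _ _ => false
  | And a b | Or a b => first_order a && first_order b
  | Ex _ a | All _ a => first_order a
  | _ => true
  end.

Fixpoint neg (phi : formula tau) : formula tau :=
  match phi with
  | Eq x y => Neq x y
  | Neq x y => Eq x y
  | Rel R xs => NRel xs
  | NRel R xs => Rel xs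
  | Inc5 ys zs => Inc5 ys zs
  | And a b => Or (neg a) (neg b)
  | Or a b => And (neg a) (neg b)
  | Ex x a => All x (neg a)
  | All x a => Ex x (neg a)
  end.

Definition imp (a b : formula tau) : formula tau := Or (neg a) b.

Section Model.
Variable M : structure tau.
Implicit Types (s : assignment M) (X : team M) (v : var -> M) (phi : formula tau).

Definition flat phi : Prop := forall X, holds X phi <-> forall s, X s -> holds [set s] phi.

Lemma flat_pointwise phi (P : assignment M -> Prop) :
  (forall X, holds X phi <-> forall s, X s -> P s) -> flat phi.
Proof.
move=> phiP X; rewrite phiP; split=> h s Xs; last exact: (phiP [set s]).1 (h s Xs) s erefl.
by apply/phiP => _ ->; apply: h.
Qed.

Lemma holds_set0 phi : flat phi -> holds (set0 : team M) phi.
Proof. by move=> /(_ set0) ->. Qed.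

Lemma holds_sub phi X Y : flat phi -> X `<=` Y -> holds Y phi -> holds X phi.
Proof. by move=> fphi XY /fphi h; apply/fphi => s /XY/h. Qed.

Lemma flat_And a b : flat a -> flat b -> flat (And a b).
Proof.
move=> fa fb X /=; rewrite fa fb; split=> [[ha hb] s Xs|h]; first by split; auto.
by split=> s /h[].
Qed.

Lemma holds1_Or a b s : flat a -> flat b ->
  holds [set s] (Or a b) <-> holds [set s] a \/ holds [set s] b.
Proof.
move=> fa fb; split=> [[Y [Z [sYZ ha hb]]]|[ha|hb]].
- have [Ys|Zs] : (Y `|` Z) s by rewrite -sYZ.
  + by left; apply: holds_sub ha => // _ ->.
  + by right; apply: holds_sub hb => // _ ->.
- by exists [set s], set0; rewrite setU0; split=> //; apply: holds_set0.
- by exists set0, [set s]; rewrite set0U; split=> //; apply: holds_set0.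
Qed.

Lemma flat_Or a b : flat a -> flat b -> flat (Or a b).
Proof.
move=> fa fb X; split=> [[Y [Z [-> ha hb]]] s [Ys|Zs]|h].
- by apply/holds1_Or => //; left; apply: holds_sub ha => // _ ->.
- by apply/holds1_Or => //; right; apply: holds_sub hb => // _ ->.
exists [set s | X s /\ holds [set s] a], [set s | X s /\ holds [set s] b]; split.
- apply/seteqP; split=> s => [Xs|[[]|[]]//].
  by have /holds1_Or[] // := h s Xs; [left|right].
- by apply/fa => s [].
- by apply/fb => s [].
Qed.

Lemma holds1_Ex x a s : flat a ->
  holds [set s] (Ex x a) <-> exists d, holds [set s.[x <- d]] a.
Proof.
move=> fa; split=> [[F [/(_ s erefl)[d Fd] h]]|[d h]].
  by exists d; apply: holds_sub h => // _ ->; exists s, d.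
exists (fun=> [set d]); split=> [_ _|]; first by exists d.
by apply: holds_sub h => // _ [_ [_ [-> -> ->]]].
Qed.

Lemma flat_Ex x a : flat a -> flat (Ex x a).
Proof.
move=> fa X; split=> [[F [F0 h]] s Xs|h].
  have [d Fd] := F0 s Xs; apply/holds1_Ex => //; exists d.
  by apply: holds_sub h => // _ ->; exists s, d.
exists (fun s => [set d | holds [set s.[x <- d]] a]); split=> [s /h/holds1_Ex[]// d ?|].
  by exists d.
by apply/fa => _ [s [d [_ hd ->]]].
Qed.

Lemma holds1_All x a s : flat a ->
  holds [set s] (All x a) <-> forall d, holds [set s.[x <- d]] a.
Proof.
move=> fa; split=> [h d|h]; first by apply: holds_sub fa _ h => _ ->; exists s, d.
by apply/fa => _ [_ [d [-> _ ->]]]; apply: h.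
Qed.

Lemma flat_All x a : flat a -> flat (All x a).
Proof.
move=> fa X; split=> [h s Xs|h].
  by apply: holds_sub fa _ h => _ [_ [d [-> _ ->]]]; exists s, d.
by apply/fa => _ [s [d [Xs _ ->]]]; move/holds1_All: (h s Xs); apply.
Qed.

Lemma first_order_flat phi : first_order phi -> flat phi.
Proof.
elim: phi => //= [????|????|????|????|a IHa b IHb|a IHa b IHb|x a IHa|x a IHa].
1-4: by apply: flat_pointwise => X; apply: iff_refl.
- by case/andP=> /IHa fa /IHb; apply: flat_And.
- by case/andP=> /IHa fa /IHb; apply: flat_Or.
- by move/IHa; apply: flat_Ex.
- by move/IHa; apply: flat_All.
Qed.

(* Tarski's semantics; the clause for [Inc5] is a dummy. *)
Fixpoint eval v phi : Prop :=
  match phi with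
  | Eq x y => v x = v y
  | Neq x y => v x <> v y
  | Rel R xs => interp (map_tuple v xs)
  | NRel R xs => ~ interp (map_tuple v xs)
  | Inc5 _ _ => True
  | And a b => eval v a /\ eval v b
  | Or a b => eval v a \/ eval v b
  | Ex x a => exists d, eval (update v x d) a
  | All x a => forall d, eval (update v x d) a
  end.

Definition agree s v (xs : seq var) : Prop := {in xs, forall x, s.[? x] = Some (v x)}.

Lemma agree_cat s v xs ys : agree s v (xs ++ ys) -> agree s v xs /\ agree s v ys.
Proof. by move=> sv; split=> x xx; apply: sv; rewrite mem_cat xx ?orbT. Qed.

Lemma agree_update s v xs x d : agree s v [seq z <- xs | z != x] ->
  agree s.[x <- d] (update v x d) xs.
Proof.
move=> sv z zxs; rewrite fnd_set /update; case: eqP => // /eqP zx.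
by apply: sv; rewrite mem_filter zx.
Qed.

Lemma values_agree s v n (xs : n.-tuple var) d : agree s v xs ->
  values s xs d <-> d = map_tuple v xs.
Proof.
move=> sv; split=> [sd|-> i]; last by rewrite tnth_map sv ?mem_tnth.
apply: eq_from_tnth => i; rewrite tnth_map.
by have := sd i; rewrite sv ?mem_tnth // => -[].
Qed.

Lemma holds1_binary s v x y (P : M -> M -> Prop) : agree s v [:: x; y] ->
  (forall t, [set s] t -> exists a b, [/\ t.[? x] = Some a, t.[? y] = Some b & P a b]) <->
  P (v x) (v y).
Proof.
move=> sv; have [sx sy] : s.[? x] = Some (v x) /\ s.[? y] = Some (v y).
  by rewrite !sv // !inE eqxx ?orbT.
split=> [/(_ s erefl)[a [b []]]|Pxy _ ->]; first by rewrite sx sy => -[->] [->].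
by exists (v x), (v y).
Qed.

Lemma holds1_tuple s v n (xs : n.-tuple var) (P : n.-tuple M -> Prop) : agree s v xs ->
  (forall t, [set s] t -> exists2 d, values t xs d & P d) <-> P (map_tuple v xs).
Proof.
move=> sv; split=> [/(_ s erefl)[d /(values_agree _ sv) ->]|h _ ->] //.
by exists (map_tuple v xs) => //; apply/(values_agree _ sv).
Qed.

Lemma holds1_eval phi s v : first_order phi -> agree s v (free_vars phi) ->
  holds [set s] phi <-> eval v phi.
Proof.
elim: phi s v => //=.
- by move=> x y s v _; apply: (holds1_binary eq).
- by move=> x y s v _; apply: (holds1_binary (fun a b => a <> b)).
- by move=> R xs s v _; apply: (holds1_tuple (fun d => interp d)).
- by move=> R xs s v _; apply: (holds1_tuple (fun d => ~ interp d)).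
- move=> a IHa b IHb s v /andP[fa fb] /agree_cat[sa sb].
  by rewrite (IHa s v) // (IHb s v).
- move=> a IHa b IHb s v /andP[fa fb] /agree_cat[sa sb].
  rewrite -[X in X <-> _]/(holds [set s] (Or a b)) holds1_Or; try exact: first_order_flat.
  by rewrite (IHa s v) // (IHb s v).
- move=> x a IHa s v fa sv.
  rewrite -[X in X <-> _]/(holds [set s] (Ex x a)) holds1_Ex; last exact: first_order_flat.
  by split=> -[d h]; exists d; move: h; rewrite (IHa _ _ fa (agree_update d sv)).
- move=> x a IHa s v fa sv.
  rewrite -[X in X <-> _]/(holds [set s] (All x a)) holds1_All; last exact: first_order_flat.
  by split=> h d; have := h d; rewrite (IHa _ _ fa (agree_update d sv)).
Qed.

Lemma eval_neg v phi : first_order phi -> eval v (neg phi) = ~ eval v phi.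
Proof.
move=> fphi; apply/propext; elim: phi v fphi => //=.
- by move=> x y v _; split=> [-> //|/contrapT].
- by move=> R xs v _; split=> [? //|/contrapT].
- by move=> a IHa b IHb v /andP[/IHa -> /IHb ->]; rewrite not_andP.
- by move=> a IHa b IHb v /andP[/IHa -> /IHb ->]; rewrite not_orP.
- move=> x a IHa v fa; rewrite -forallNP.
  by split=> h d; have := h d; rewrite IHa.
- move=> x a IHa v fa; rewrite -existsNP.
  by split=> -[d h]; exists d; move: h; rewrite IHa.
Qed.

Lemma eval_And v a b : eval v (And a b) = (eval v a /\ eval v b).
Proof. by []. Qed.

Lemma eval_imp v a b : first_order a -> eval v (imp a b) = (eval v a -> eval v b).
Proof.
move=> fa; rewrite [LHS]/= eval_neg //; apply/propext; split=> [[]//|ab].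
by have [/ab|] := pselect (eval v a); [right|left].
Qed.

Lemma holds_ExP x a X : holds X (Ex x a) <-> exists Y : team M,
  [/\ forall s, X s -> exists d, Y s.[x <- d],
      forall t, Y t -> exists s d, X s /\ t = s.[x <- d] & holds Y a].
Proof.
split=> [[F [F0 h]]|[Y [XY YX h]]].
  exists (supplement X F x); split=> // [s Xs|t [s [d [Xs _ ->]]]]; last by exists s, d.
  by have [d Fd] := F0 s Xs; exists d, s, d.
exists (fun s => [set d | Y s.[x <- d]]); split=> //.
rewrite (_ : supplement _ _ _ = Y) //; apply/seteqP; split=> [_ [s [d [_ Yd ->]]]//|t Yt].
by have [s [d [Xs E]]] := YX t Yt; rewrite E in Yt *; exists s, d.
Qed.

End Model.

End FirstOrder.

(** * Teams over four variables *)

Section Rows.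
Variables (tau : vocabulary) (M : structure tau).
Implicit Types (phi lit : formula tau) (X : team M) (T : M -> M -> M -> Prop)
  (Q : M -> M -> M -> M -> Prop).

Definition fo_matrix phi : bool :=
  [&& first_order phi, quantifier_free phi & all (gtn 4) (free_vars phi)].

Lemma fo_matrix_And a b : fo_matrix (And a b) = fo_matrix a && fo_matrix b.
Proof. by rewrite /fo_matrix /= all_cat [X in _ && X]andbACA andbACA. Qed.

Definition env (a b c d : M) : var -> M := nth d [:: a; b; c].

Definition row (a b c d : M) : assignment M :=
  [fmap].[0 <- a].[1 <- b].[2 <- c].[3 <- d].

Lemma rowE a b c d x : x < 4 -> (row a b c d).[? x] = Some (env a b c d x).
Proof. by move: x => [|[|[|[|]]]] //= _; rewrite !fnd_set. Qed.

Lemma agree_row a b c d xs : all (gtn 4) xs -> agree (row a b c d) (env a b c d) xs.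
Proof. by move=> /allP lt4 x /lt4; apply: rowE. Qed.

Definition rows Q : team M := [set s | exists a b c d, Q a b c d /\ s = row a b c d].

Lemma rowsP Q a b c d : rows Q (row a b c d) <-> Q a b c d.
Proof.
split=> [[a' [b' [c' [d' [Qabcd E]]]]]|]; last by exists a, b, c, d.
have {}E x : x < 4 -> env a b c d x = env a' b' c' d' x.
  by move=> x4; apply: Some_inj; rewrite -(rowE a b c d x4) -(rowE a' b' c' d' x4) E.
by rewrite (E 0 isT : a = a') (E 1 isT : b = b') (E 2 isT : c = c') (E 3 isT : d = d').
Qed.

Lemma holds_rows Q phi : fo_matrix phi ->
  holds (rows Q) phi <-> forall a b c d, Q a b c d -> eval (env a b c d) phi.
Proof.
case/and3P=> fphi _ vphi; rewrite (first_order_flat fphi); split.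
  move=> h a b c d Qabcd; apply/(holds1_eval fphi (agree_row _ _ _ _ vphi))/h.
  exact/rowsP.
move=> h _ [a [b [c [d [/h Qabcd ->]]]]].
exact/(holds1_eval fphi (agree_row _ _ _ _ vphi)).
Qed.

Lemma rows_sub X Q : X `<=` rows Q -> X = rows (fun a b c d => X (row a b c d)).
Proof.
move=> XQ; apply/seteqP; split=> [s Xs|_ [a [b [c [d [? ->]]]]] //].
by have [a [b [c [d [_ E]]]]] := XQ _ Xs; exists a, b, c, d; rewrite -E.
Qed.

Lemma holds_rows_Or Q phi psi : holds (rows Q) (Or phi psi) <-> exists Q1 Q2,
  [/\ forall a b c d, Q a b c d <-> Q1 a b c d \/ Q2 a b c d,
      holds (rows Q1) phi & holds (rows Q2) psi].
Proof.
split=> [[Y [Z [E hY hZ]]]|[Q1 [Q2 [E h1 h2]]]].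
  exists (fun a b c d => Y (row a b c d)), (fun a b c d => Z (row a b c d)); split.
  - by move=> a b c d; rewrite -(rowsP Q) E.
  - by rewrite -(@rows_sub _ Q) // E; apply: subsetUl.
  - by rewrite -(@rows_sub _ Q) // E; apply: subsetUr.
exists (rows Q1), (rows Q2); split=> //; apply/seteqP; split.
  by move=> _ [a [b [c [d [/E[q|q] ->]]]]]; [left|right]; apply/rowsP.
by move=> _ [] [a [b [c [d [q ->]]]]]; apply/rowsP/E; [left|right].
Qed.

Definition pair_inc (x x' y y' : var) : formula tau :=
  Inc5 [tuple x; x; x; x; x'] [tuple y; y; y; y; y'].

Lemma values_pair (s : assignment M) x x' (d : 5.-tuple M) :
  values s [tuple x; x; x; x; x'] d <-> exists e e',
    [/\ d = [tuple e; e; e; e; e'], s.[? x] = Some e & s.[? x'] = Some e'].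
Proof.
split=> [sd|[e [e' [-> sx sx']]]]; last by case=> -[|[|[|[|[|]]]]].
exists (tnth d ord0), (tnth d ord_max); split; [|exact: sd ord0|exact: sd ord_max].
apply: eq_from_tnth => -[[|[|[|[|[|]]]]] i5] //; apply: Some_inj; rewrite -sd;
  by [exact: sd ord0|exact: sd ord_max].
Qed.

Lemma holds_pair_inc Q x x' y y' : all (gtn 4) [:: x; x'; y; y'] ->
  holds (rows Q) (pair_inc x x' y y') <-> forall a b c d, Q a b c d ->
  exists a' b' c' d', [/\ Q a' b' c' d', env a' b' c' d' y = env a b c d x &
    env a' b' c' d' y' = env a b c d x'].
Proof.
case/and5P=> x4 x'4 y4 y'4 _; split=> [h a b c d Qabcd|h d [_ [a [b [c [d' [Qabcd ->]]]]]]].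
  have [|_ [a' [b' [c' [d' [Q' ->]]]]] /values_pair[e [e' []]]] :=
    h [tuple env a b c d x; env a b c d x; env a b c d x; env a b c d x; env a b c d x'].
    exists (row a b c d); first exact/rowsP.
    by apply/values_pair; exists (env a b c d x), (env a b c d x'); rewrite !rowE.
  move=> /(congr1 val)[-> _ _ _ ->]; rewrite !rowE // => -[Ey] [Ey'].
  by exists a', b', c', d'.
move=> /values_pair[e [e' [->]]]; rewrite !rowE // => -[<-] [<-].
have [a1 [b1 [c1 [d1 [Q1 Ey Ey']]]]] := h _ _ _ _ Qabcd.
exists (row a1 b1 c1 d1); first exact/rowsP.
by apply/values_pair; exists (env a b c d' x), (env a b c d' x'); rewrite !rowE // Ey Ey'.
Qed.

Definition triples T : team M := rows (fun a b c _ => T a b c).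

(* Says that every first component of the team has a row satisfying lit: the
   rows in which variable 3 differs from variable 0 satisfy the inclusion atom,
   which sends them to rows in which these variables agree. *)
Definition some_row lit : formula tau :=
  Or (Eq 3 0) (And (Or (Neq 3 0) lit) (pair_inc 0 0 0 3)).

Lemma holds_some_row T lit : fo_matrix lit -> (forall a b c, T a b c -> a <> b) ->
  holds (triples T) (some_row lit) <->
  forall a b c, T a b c -> exists b' c', T a b' c' /\ eval (env a b' c' a) lit.
Proof.
move=> mlit Tneq; have m_or : fo_matrix (Or (Neq 3 0) lit) by [].
rewrite holds_rows_Or; split=> [[Q1 [Q2 [E h1 [h2 h3]]]] a b c Tabc|h].
  have Q2b : Q2 a b c b.
    have [Q1b|//] := (E a b c b).1 Tabc.
    have ba : b = a := (@holds_rows Q1 (Eq 3 0) isT).1 h1 _ _ _ _ Q1b.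
    by case: (Tneq _ _ _ Tabc).
  have [a' [b' [c' [d' [Q' Ea Ed]]]]] := (@holds_pair_inc Q2 0 0 0 3 isT).1 h3 _ _ _ _ Q2b.
  rewrite (Ea : a' = a) (Ed : d' = a) in Q'; exists b', c'.
  split; first by apply/(E _ _ _ a); right.
  by have [] := (holds_rows _ m_or).1 h2 _ _ _ _ Q'.
exists (fun a b c d => T a b c /\ d = a),
  (fun a b c d => T a b c /\ (d <> a \/ eval (env a b c d) lit)); split.
- move=> a b c d; split=> [Tabc|[[]|[]]//].
  by have [?|?] := pselect (d = a); [left|right; split; [|left]].
- by apply/holds_rows => // a b c d [].
split; first by apply/(holds_rows _ m_or) => a b c d [].
apply/holds_pair_inc => // a b c d [/h[b' [c' [Tabc la]]] _].
by exists a, b', c', a; split=> //; split=> //; right.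
Qed.

Definition prefixed (theta : formula tau) : formula tau := Ex 0 (Ex 1 (Ex 2 (All 3 theta))).

Lemma prefixed_E3A theta : quantifier_free theta -> all (gtn 4) (free_vars theta) ->
  E3A_sentence (prefixed theta).
Proof.
move=> qtheta vtheta; split; last by exists 0, 1, 2, 3, theta.
rewrite /sentence /= -!filter_predI; apply/eqP; rewrite -(negbK (_ == _)) -has_filter.
by apply/hasPn => x /(allP vtheta) /=; case: x => [|[|[|[|]]]].
Qed.

Lemma true_prefixed theta : true_in M (prefixed theta) <->
  exists T, (exists a b c, T a b c) /\ holds (triples T) theta.
Proof.
pose row1 a : assignment M := [fmap].[0 <- a].
pose row2 a b := (row1 a).[1 <- b]; pose row3 a b c := (row2 a b).[2 <- c].
rewrite /true_in holds_ExP; split.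
  case=> X1 [emp1 X1emp /holds_ExP[X2 [X12 X21 /holds_ExP[X3 [X23 X32 h]]]]].
  exists (fun a b c => X3 (row3 a b c)); split.
    have [a /X12[b /X23[c abc]]] := emp1 _ erefl.
    by exists a, b, c.
  suff <- : supplement X3 (fun=> setT) 3 = triples (fun a b c => X3 (row3 a b c)) by [].
  apply/seteqP; split=> [_ [s3 [d [X3s3 _ ->]]]|_ [a [b [c [d [X3abc ->]]]]]].
    have [s2 [c [/X21[s1 [b [/X1emp[_ [a [-> E1]]] E2]]] E3]]] := X32 _ X3s3.
    have E : s3 = row3 a b c by rewrite E3 E2 E1.
    by exists a, b, c, d; rewrite E in X3s3 *.
  by exists (row3 a b c), d.
case=> T [[a0 [b0 [c0 T0]]] h].
exists [set s | exists a b c, T a b c /\ s = row1 a]; split.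
- by move=> _ ->; exists a0, a0, b0, c0.
- by move=> _ [a [b [c [_ ->]]]]; exists [fmap], a.
apply/holds_ExP; exists [set s | exists a b c, T a b c /\ s = row2 a b]; split.
- by move=> _ [a [b [c [Tabc ->]]]]; exists b, a, b, c.
- by move=> _ [a [b [c [Tabc ->]]]]; exists (row1 a), b; split=> //; exists a, b, c.
apply/holds_ExP; exists [set s | exists a b c, T a b c /\ s = row3 a b c]; split.
- by move=> _ [a [b [c [Tabc ->]]]]; exists c, a, b, c.
- by move=> _ [a [b [c [Tabc ->]]]]; exists (row2 a b), c; split=> //; exists a, b, c.
rewrite /= (_ : supplement _ _ _ = triples T) //; apply/seteqP; split.
  by move=> _ [_ [d [[a [b [c [Tabc ->]]]] _ ->]]]; exists a, b, c, d.
by move=> _ [a [b [c [d [Tabc ->]]]]]; exists (row3 a b c), d; split=> //; exists a, b, c.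
Qed.

End Rows.

(** * History machines and their formulas *)

Inductive history := Base of bool | Node of nat & nat & history & history.

HB.instance Definition _ := gen_eqMixin history.
HB.instance Definition _ := gen_choiceMixin history.

Definition node_label (h : history) : option nat := if h is Node n _ _ _ then Some n else None.
Definition node_tag (h : history) : nat := if h is Node _ k _ _ then k.+1 else 0.
Definition previous (h : history) : option history := if h is Node _ _ p _ then Some p else None.
Definition pointer (h : history) : option history := if h is Node _ _ _ c then Some c else None.

Inductive move := Stay | Recall | PtrOfPtr | PrevOfPtr.

Definition target (m : move) (p c : history) : option history :=
  match m with
  | Stay => Some c
  | Recall => Some p
  | PtrOfPtr => pointer c
  | PrevOfPtr => previous c
  end.

Record action := Action { written : nat; mov : move; goto : nat }.
Record instr := Instr { tested : nat; act_eq : action; act_neq : action }.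

Definition jump (A : action) : instr := Instr 0 A A.

Definition act (i : instr) (c : history) : action :=
  if node_tag c == tested i then act_eq i else act_neq i.

Definition instr_tags (i : instr) : seq nat :=
  [:: tested i; (written (act_eq i)).+1; (written (act_neq i)).+1].

Lemma written_instr_tags i c : (written (act i c)).+1 \in instr_tags i.
Proof. by rewrite /act; case: ifP; rewrite !inE eqxx ?orbT. Qed.

Definition start : history := Node 1 0 (Base true) (Base false).

Section Machine.
Variable code : nat -> option instr.

Inductive step : history -> history -> Prop :=
| Step n k p c i c' : code n = Some i -> target (mov (act i c)) p c = Some c' ->
    step (Node n k p c) (Node (goto (act i c)) (written (act i c)) (Node n k p c) c').

Definition run : history -> history -> Prop := clos_refl_trans history step.

Lemma stepP h h' : step h h' -> exists n k p c i c',
  [/\ h = Node n k p c, code n = Some i, target (mov (act i c)) p c = Some c' &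
      h' = Node (goto (act i c)) (written (act i c)) h c'].
Proof. by case=> n k p c i c' En Ec'; exists n, k, p, c, i, c'. Qed.

End Machine.

Definition tau_formula : Type := formula tau_bin_un.

Definition edgeF (x y : var) : tau_formula := @Rel tau_bin_un Bin [tuple x; y].
Definition markF (k : nat) (x : var) : tau_formula := @Rel tau_bin_un (Un k) [tuple x].
Definition topF : tau_formula := Eq 3 3.

Definition allF (F : nat -> tau_formula) (s : seq nat) : tau_formula :=
  foldr (fun k phi => And (F k) phi) topF s.

(* Marks 0, 1 and 2 give the length of a history modulo 3, which orients the
   symmetric edges. *)
Definition prevF (x y : var) : tau_formula :=
  And (edgeF x y) (And (edgeF y x)
    (Or (And (markF 0 y) (markF 1 x))
        (Or (And (markF 1 y) (markF 2 x)) (And (markF 2 y) (markF 0 x))))).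
Definition ptrF (x y : var) : tau_formula := And (edgeF x y) (neg (edgeF y x)).
Definition startF (x : var) : tau_formula := markF 3 x.
Definition labelF (n : nat) (x : var) : tau_formula := markF n.*2.+4 x.
Definition tagF (k : nat) (x : var) : tau_formula := markF k.*2.+4.+1 x.

(* In the rows of the team, variable 0 is a node, 1 its pointer, 2 the next node
   or the first one, and 3 is arbitrary. *)
Definition moveF (m : move) : tau_formula :=
  match m with
  | Stay => ptrF 0 3
  | Recall => prevF 0 3
  | PtrOfPtr => ptrF 1 3
  | PrevOfPtr => prevF 1 3
  end.

Definition actionF (A : action) : tau_formula :=
  And (labelF (goto A) 2) (And (tagF (written A).+1 2) (imp (ptrF 2 3) (moveF (mov A)))).

Definition branchF (i : instr) : tau_formula :=
  And (imp (tagF (tested i) 1) (actionF (act_eq i)))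
      (imp (neg (tagF (tested i) 1)) (actionF (act_neq i))).

Definition instrF (n : nat) (i : instr) : tau_formula :=
  imp (neg (startF 2)) (imp (labelF n 0) (And (imp (prevF 2 3) (Eq 3 0)) (branchF i))).

Definition pointerF : tau_formula :=
  And (Neq 0 1) (And (ptrF 0 1) (imp (ptrF 0 3) (Eq 3 1))).

Definition initF : tau_formula :=
  imp (startF 0) (And (labelF 1 0) (And (tagF 1 0)
    (And (tagF 0 1) (imp (prevF 0 3) (tagF 0 3))))).

Definition exclusiveF (tags : seq nat) : tau_formula :=
  allF (fun k => allF (fun l =>
    if k == l then topF else imp (tagF k 3) (neg (tagF l 3))) tags) tags.

Definition frameF (tags : seq nat) (forbidden : nat) : tau_formula :=
  And pointerF (And initF (And (neg (labelF forbidden 0)) (exclusiveF tags))).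

Definition coreF (chi : tau_formula) : tau_formula :=
  And (pair_inc _ 2 2 0 0) (And (some_row (startF 2)) (And (some_row (neg (startF 2))) chi)).

Lemma fo_matrix_allF F s : (forall k, fo_matrix (F k)) -> fo_matrix (allF F s).
Proof. by move=> mF; elim: s => //= k s IHs; rewrite fo_matrix_And mF. Qed.

Lemma fo_matrix_instrF n i : fo_matrix (instrF n i).
Proof. by case: i => k [w [] l] [w' [] l']. Qed.

Lemma fo_matrix_frameF tags forbidden : fo_matrix (frameF tags forbidden).
Proof.
rewrite /frameF !fo_matrix_And /=; apply: fo_matrix_allF => k.
by apply: fo_matrix_allF => l; case: ifP.
Qed.

Section Meaning.
Variable M : structure tau_bin_un.
Implicit Types (v : var -> M) (a b c d : M) (T : M -> M -> M -> Prop).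

Definition edgeM a b : Prop := @interp _ M Bin [tuple a; b].
Definition markM (k : nat) a : Prop := @interp _ M (Un k) [tuple a].

Definition prevM a b : Prop :=
  edgeM a b /\ edgeM b a /\
  (markM 0 b /\ markM 1 a \/ markM 1 b /\ markM 2 a \/ markM 2 b /\ markM 0 a).
Definition ptrM a b : Prop := edgeM a b /\ ~ edgeM b a.
Definition startM a : Prop := markM 3 a.
Definition labelM n a : Prop := markM n.*2.+4 a.
Definition tagM k a : Prop := markM k.*2.+4.+1 a.

Definition moveM (m : move) a b d : Prop :=
  match m with
  | Stay => ptrM a d
  | Recall => prevM a d
  | PtrOfPtr => ptrM b d
  | PrevOfPtr => prevM b d
  end.

Definition actionM (A : action) a b c d : Prop :=
  labelM (goto A) c /\ tagM (written A).+1 c /\ (ptrM c d -> moveM (mov A) a b d).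

Definition branchM (i : instr) a b c d : Prop :=
  (tagM (tested i) b -> actionM (act_eq i) a b c d) /\
  (~ tagM (tested i) b -> actionM (act_neq i) a b c d).

Definition instrM (n : nat) (i : instr) a b c d : Prop :=
  ~ startM c -> labelM n a -> (prevM c d -> d = a) /\ branchM i a b c d.

Definition pointerM a b d : Prop := a <> b /\ ptrM a b /\ (ptrM a d -> d = b).

Definition initM a b d : Prop :=
  startM a -> labelM 1 a /\ tagM 1 a /\ tagM 0 b /\ (prevM a d -> tagM 0 d).

Definition exclusiveM (tags : seq nat) d : Prop :=
  {in tags &, forall k l, tagM k d -> tagM l d -> k = l}.

Definition frameM (tags : seq nat) (forbidden : nat) a b d : Prop :=
  pointerM a b d /\ initM a b d /\ ~ labelM forbidden a /\ exclusiveM tags d.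

Lemma eval_edgeF v x y : eval v (edgeF x y) = edgeM (v x) (v y).
Proof. by rewrite /edgeM /=; congr (interp _); apply: val_inj. Qed.

Lemma eval_markF v k x : eval v (markF k x) = markM k (v x).
Proof. by rewrite /markM /=; congr (interp _); apply: val_inj. Qed.

Lemma eval_prevF v x y : eval v (prevF x y) = prevM (v x) (v y).
Proof. by rewrite /prevM -!(eval_edgeF v) -!(eval_markF v). Qed.

Lemma eval_ptrF v x y : eval v (ptrF x y) = ptrM (v x) (v y).
Proof. by rewrite /ptrF eval_And eval_neg // !eval_edgeF. Qed.

Lemma eval_moveF a b c d m : eval (env a b c d) (moveF m) = moveM m a b d.
Proof. by case: m; rewrite ?eval_ptrF ?eval_prevF. Qed.

Lemma eval_actionF a b c d A : eval (env a b c d) (actionF A) = actionM A a b c d.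
Proof. by rewrite /actionF !eval_And eval_imp // !eval_markF eval_ptrF eval_moveF. Qed.

Lemma eval_branchF a b c d i : eval (env a b c d) (branchF i) = branchM i a b c d.
Proof. by rewrite /branchF eval_And !eval_imp // !eval_actionF eval_neg // !eval_markF. Qed.

Lemma eval_instrF a b c d n i : eval (env a b c d) (instrF n i) = instrM n i a b c d.
Proof.
rewrite /instrF !eval_imp // eval_neg // eval_And eval_branchF eval_imp //.
by rewrite !eval_markF eval_prevF.
Qed.

Lemma eval_allF v F s : eval v (allF F s) = {in s, forall k, eval v (F k)}.
Proof.
apply/propext; elim: s => [|k s IHs]; first by split.
split=> [[vk /IHs vs] l|h]; first by rewrite inE => /predU1P[->|/vs].
by split; [apply: h; rewrite mem_head|apply/IHs => l ls; apply: h; rewrite inE ls orbT].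
Qed.

Lemma eval_exclusiveF a b c d tags :
  eval (env a b c d) (exclusiveF tags) = exclusiveM tags d.
Proof.
apply/propext; rewrite eval_allF; split=> [h k l kL lL|h k kL].
  have := h k kL; rewrite eval_allF => /(_ l lL); case: eqP => // _.
  by rewrite eval_imp // eval_neg // !eval_markF => kl /kl.
rewrite eval_allF => l lL; case: eqP => // kl.
by rewrite eval_imp // eval_neg // !eval_markF => dk dl; apply/kl/h.
Qed.

Lemma eval_frameF a b c d tags forbidden :
  eval (env a b c d) (frameF tags forbidden) = frameM tags forbidden a b d.
Proof.
rewrite /frameF !(eval_ptrF, eval_prevF, eval_exclusiveF, eval_And, eval_imp) //.
by rewrite eval_neg // !eval_markF.
Qed.

Record live T : Prop := Live {
  live_next : forall a b c, T a b c -> exists b' c', T c b' c';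
  live_start : forall a b c, T a b c -> exists b' c', T a b' c' /\ startM c';
  live_step : forall a b c, T a b c -> exists b' c', T a b' c' /\ ~ startM c' }.

Lemma holds_coreF T chi : fo_matrix chi ->
  (forall a b c d, eval (env a b c d) chi -> a <> b) ->
  holds (triples T) (coreF chi) <->
  live T /\ forall a b c d, T a b c -> eval (env a b c d) chi.
Proof.
move=> mchi chi_neq; set T_chi := forall a b c d, _.
have chiP : holds (triples T) chi <-> T_chi by apply: holds_rows.
have nextP := @holds_pair_inc _ M (fun a b c _ => T a b c) 2 2 0 0 isT.
have startP := @holds_some_row _ M T (startF 2) isT.
have stepP := @holds_some_row _ M T (neg (startF 2)) isT.
have Tneq : T_chi -> forall a b c, T a b c -> a <> b.
  by move=> h a b c /(h _ _ _ a)/chi_neq.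
rewrite /coreF; split=> [[/nextP hn [hs [ht /chiP hchi]]]|[[hn hs ht] hchi]].
  split=> //; split=> a b c Tabc.
  - by have [a' [b' [c' [d' [T' Ec _]]]]] := hn _ _ _ a Tabc; exists b', c'; rewrite -[c]Ec.
  - have [b' [c' [T']]] := (startP (Tneq hchi)).1 hs _ _ _ Tabc.
    by rewrite eval_markF; exists b', c'.
  - have [b' [c' [T']]] := (stepP (Tneq hchi)).1 ht _ _ _ Tabc.
    by rewrite eval_neg // eval_markF; exists b', c'.
split.
  by apply/nextP => a b c d /hn[b' [c' T']]; exists c, b', c', c.
split.
  by apply/(startP (Tneq hchi)) => a b c /hs[b' [c' [T' c's]]]; exists b', c'; rewrite eval_markF.
split; last exact/chiP.
apply/(stepP (Tneq hchi)) => a b c /ht[b' [c' [T' c's]]]; exists b', c'.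
by rewrite eval_neg // eval_markF.
Qed.

End Meaning.

(** * Models of the formula of a machine contain its run *)

Record simulates (code : nat -> option instr) (tags : seq nat) (forbidden : nat)
    (M : structure tau_bin_un) (T : M -> M -> M -> Prop) : Prop := Simulates {
  sim_live : live T;
  sim_frame : forall a b c d, T a b c -> frameM tags forbidden a b d;
  sim_instr : forall n i a b c d, code n = Some i -> T a b c -> instrM n i a b c d }.

Section Soundness.
Variables (code : nat -> option instr) (tags : seq nat) (forbidden : nat).
Hypothesis base_tag : 0 \in tags.
Hypothesis start_tag : 1 \in tags.
Hypothesis code_tags : forall n i, code n = Some i -> {subset instr_tags i <= tags}.
Variables (M : structure tau_bin_un) (T : M -> M -> M -> Prop).
Hypothesis sim : simulates code tags forbidden T.

(* Universally quantified over predecessors and pointers: a pointer is known to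
   exist only for the first components of the team. *)
Fixpoint represents (h : history) (a : M) : Prop :=
  match h with
  | Base _ => tagM 0 a
  | Node n k p c => [/\ labelM n a, tagM k.+1 a, k.+1 \in tags,
      forall d, prevM a d -> represents p d & forall d, ptrM a d -> represents c d]
  end.

Lemma represents_tag h a : represents h a -> tagM (node_tag h) a /\ node_tag h \in tags.
Proof. by case: h => [b|n k p c] //= []. Qed.

Lemma represents_target n k p c c' m a b d : represents (Node n k p c) a -> ptrM a b ->
  target m p c = Some c' -> moveM m a b d -> represents c' d.
Proof.
move=> [_ _ _ rp rc] /rc rb; case: m => /= [[<-] /rc|[<-] /rp||] //.
  by case: c rb {rc} => //= n1 k1 p1 c1 [_ _ _ _ rc1] [<-] /rc1.
by case: c rb {rc} => //= n1 k1 p1 c1 [_ _ _ rp1 _] [<-] /rp1.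
Qed.

Lemma start_represented : (exists a b c, T a b c) ->
  exists2 a, represents start a & exists b c, T a b c.
Proof.
case=> a [b [c /(live_start (sim_live sim))[b1 [h [Tabh hs]]]]].
have [b' [c' Th]] := live_next (sim_live sim) Tabh; exists h; last by exists b', c'.
have frame d := sim_frame sim d Th.
have init d : labelM 1 h /\ tagM 1 h /\ tagM 0 b' /\ (prevM h d -> tagM 0 d).
  by have [_ [/(_ hs)]] := frame d.
have [lh [th [tb _]]] := init h; split=> // [d|d].
  by have [_ [_ []]] := init d.
by have [[_ [_ db]] _] := frame d; move=> /db ->.
Qed.

Lemma branch_taken i c a b c' d : branchM i a b c' d -> represents c b ->
  tested i \in tags -> exclusiveM tags b -> actionM (act i c) a b c' d.
Proof.
move=> [branch_eq branch_neq] /represents_tag[tb cL] iL excl; rewrite /act.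
by case: eqP => [E|ne]; [apply: branch_eq; rewrite -E|apply: branch_neq => /(excl _ _ cL iL tb)].
Qed.

Lemma step_represented h h' a : step code h h' ->
  represents h a -> (exists b c, T a b c) ->
  exists2 a', represents h' a' & exists b c, T a' b c.
Proof.
case=> n k p c i c' En Ec' ra [b0 [c0 /(live_step (sim_live sim))[b [a' [Tab ns]]]]].
exists a'; last exact: (live_next (sim_live sim) Tab).
have [[_ [pab _]] _] := sim_frame sim a Tab.
have [la _ _ _ /(_ b pab) rb] := ra.
have acts d : (prevM a' d -> d = a) /\ actionM (act i c) a b a' d.
  have [prev_a branch] := sim_instr sim d En Tab ns la; split=> //.
  apply: branch_taken branch rb _ _; first by apply: code_tags En _ _; rewrite mem_head.
  by have [_ [_ []]] := sim_frame sim b Tab.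
have [_ [la' [ta' _]]] := acts a'; split=> //.
- by apply: code_tags En _ (written_instr_tags i c).
- by move=> d a'd; have [/(_ a'd) -> _] := acts d.
- move=> d a'd; have [_ [_ [_ /(_ a'd)]]] := acts d.
  exact: represents_target ra pab Ec'.
Qed.

Lemma run_avoids_forbidden h : (exists a b c, T a b c) -> run code start h ->
  node_label h <> Some forbidden.
Proof.
move=> /start_represented[a0 ra0 Ta0] start_h.
have [a] : exists2 a, represents h a & exists b c, T a b c.
  elim/clos_refl_trans_ind_left: _ / start_h => [|u v _ [a ra Ta] /step_represented].
    by exists a0.
  by apply; eauto.
case: h {start_h} => //= n k p c [la _ _ _ _] [b [c' Tabc]] [E]; rewrite {}E in la.
by have [_ [_ []]] := sim_frame sim a Tabc.
Qed.

End Soundness.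

(** * The history of a halting run is a finite model *)

Fixpoint subhistories (h : history) : seq history :=
  h :: if h is Node _ _ p c then subhistories p ++ subhistories c else [::].

Lemma subhistories_refl h : h \in subhistories h.
Proof. by case: h => *; rewrite mem_head. Qed.

Lemma subhistories_trans h u v :
  u \in subhistories h -> v \in subhistories u -> v \in subhistories h.
Proof.
elim: h => [b|n k p IHp c IHc] /=; first by rewrite inE => /eqP ->.
rewrite inE mem_cat => /predU1P[-> //|/orP[/IHp h|/IHc h] /h]; rewrite inE mem_cat => ->.
  by rewrite orbT.
by rewrite !orbT.
Qed.

Lemma subhistories_prev h u : previous h = Some u -> u \in subhistories h.
Proof. by case: h => //= n k p c [<-]; rewrite inE mem_cat subhistories_refl orbT. Qed.

Lemma subhistories_ptr h u : pointer h = Some u -> u \in subhistories h.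
Proof. by case: h => //= n k p c [<-]; rewrite inE mem_cat subhistories_refl !orbT. Qed.

Fixpoint depth (h : history) : nat := if h is Node _ _ p _ then (depth p).+1 else 0.

Lemma depth_prev h u : previous h = Some u -> depth h = (depth u).+1.
Proof. by case: h => // n k p c [->]. Qed.

Fixpoint well_formed (h : history) : Prop :=
  if h is Node _ _ p c then [/\ well_formed p, well_formed c, c <> p & depth c <= depth p]
  else True.

Lemma well_formed_sub h u : well_formed h -> u \in subhistories h -> well_formed u.
Proof.
elim: h => [b _|n k p IHp c IHc [wp wc cp dc]] /=; first by rewrite inE => /eqP ->.
rewrite inE mem_cat => /predU1P[->|]; first by split.
by move=> /orP[/IHp|/IHc]; apply.
Qed.

Lemma depth_ptr h u : well_formed h -> pointer h = Some u -> depth u < depth h.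
Proof. by case: h => // n k p c [_ _ _ dc] [<-]. Qed.

Lemma prev_neq_ptr h u : well_formed h -> previous h = Some u -> pointer h <> Some u.
Proof. by case: h => // n k p c [_ _ cp _] [<-] [/cp]. Qed.

Lemma well_formed_target n k p c m c' : well_formed (Node n k p c) ->
  target m p c = Some c' -> well_formed c' /\ depth c' <= depth p.
Proof.
move=> [wp wc _ dc]; case: m => /= [[<-]|[<-]|E|E] //.
  split; first by apply: well_formed_sub wc _; apply: subhistories_ptr.
  by apply: leq_trans (ltnW (depth_ptr wc E)) dc.
split; first by apply: well_formed_sub wc _; apply: subhistories_prev.
by apply: leq_trans dc; rewrite (depth_prev E).
Qed.

Section Runs.
Variable code : nat -> option instr.

Lemma run_well_formed h : run code start h -> well_formed h.
Proof.
move=> r; elim/clos_refl_trans_ind_left: _ / r => [|u v _ wu uv]; first by split.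
case: uv wu => n k p c i c' _ Ec' wu.
have [wc' dc'] := well_formed_target wu Ec'.
split=> //; last exact: leqW.
by move=> E; rewrite E /= ltnn in dc'.
Qed.

Lemma run_node h : run code start h -> exists n k p c, h = Node n k p c.
Proof.
move=> r; elim/clos_refl_trans_ind_left: _ / r => [|u v _ _ [n k p c i c' _ _]];
  by do 4!eexists.
Qed.

Lemma run_subhistories h h' : run code h h' -> h \in subhistories h'.
Proof.
move=> r; elim/clos_refl_trans_ind_left: _ / r => [|u v _ hu uv]; first exact: subhistories_refl.
by apply: subhistories_trans hu; apply: subhistories_prev; case: uv.
Qed.

Lemma run_first_step h h' : run code h h' -> h = h' \/ exists2 u, step code h u & run code u h'.
Proof.
move=> r; case: (clos_rt_rt1n _ _ _ _ r) => [|u v hu uv]; first by left.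
by right; exists u; last exact: clos_rt1n_rt uv.
Qed.

Lemma step_start h : ~ step code h start.
Proof. by move=> hs; inversion hs. Qed.

End Runs.

Section HistoryModel.
Variable final : history.

Definition history_edge (u v : history) : Prop :=
  [\/ previous u = Some v, previous v = Some u | pointer u = Some v].

Definition history_mark (k : nat) (u : history) : Prop :=
  match k with
  | 3 => u = start
  | l.+4 => if odd l then node_tag u = l./2 else node_label u = Some l./2
  | _ => depth u %% 3 = k
  end.

Definition history_node : Type := seq_sub (subhistories final).

Lemma history_node_inhabited : inhabited history_node.
Proof. by constructor; exists final; apply: subhistories_refl. Qed.

Definition history_interp (R : tau_sym) (s : seq history_node) : Prop :=
  match R, s with
  | Bin, [:: u; v] => history_edge (ssval u) (ssval v)
  | Un k, [:: u] => history_mark k (ssval u)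
  | _, _ => False
  end.

Definition history_model : structure tau_bin_un :=
  @Structure tau_bin_un history_node history_node_inhabited (fun R xs => history_interp R xs).

Implicit Types a b c d u v : history_model.

Lemma history_model_finite : finite_set [set: history_model].
Proof. exact: finite_finset. Qed.

Lemma label_history n u : labelM n u <-> node_label (ssval u) = Some n.
Proof. by rewrite /labelM /markM /= odd_double /= doubleK. Qed.

Lemma tag_history n u : tagM n u <-> node_tag (ssval u) = n.
Proof. by rewrite /tagM /markM /= odd_double /= uphalf_double. Qed.

Lemma start_history u : startM u <-> ssval u = start.
Proof. by []. Qed.

Hypothesis final_wf : well_formed final.

Lemma node_well_formed u : well_formed (ssval u).
Proof. exact: well_formed_sub final_wf (ssvalP u). Qed.

Lemma ptr_not_edge u v : pointer (ssval u) = Some (ssval v) -> ~ history_edge (ssval v) (ssval u).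
Proof.
move=> uv; have lt_uv := depth_ptr (node_well_formed u) uv.
case=> [/depth_prev E|/(prev_neq_ptr (node_well_formed u))|].
- by move: lt_uv; rewrite E ltnNge leqnSn.
- exact.
- by move=> /(depth_ptr (node_well_formed v)); rewrite ltnNge ltnW.
Qed.

Lemma ptr_history u v : ptrM u v <-> pointer (ssval u) = Some (ssval v).
Proof.
split=> [[[uv|vu|//] n_vu]|uv]; [by case: n_vu; constructor 2|by case: n_vu; constructor 1|].
by split; [constructor 3|apply: ptr_not_edge].
Qed.

Lemma prev_history u v : prevM u v <-> previous (ssval u) = Some (ssval v).
Proof.
have depth3 x y : previous x = Some y -> depth x %% 3 = (depth y %% 3).+1 %% 3.
  by move=> /depth_prev ->; rewrite -[(depth y).+1]addn1 -modnDml addn1.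
rewrite /prevM /markM /edgeM /=; split=> [[[//|vu|uv] [e_vu marks]]|uv].
- by move: marks; rewrite (depth3 _ _ vu) => -[|[|]] [Ev Eu]; rewrite Eu in Ev.
- by case: (ptr_not_edge uv).
split; [by constructor 1|split; first by constructor 2].
rewrite (depth3 _ _ uv).
by case: (depth _ %% 3) (ltn_pmod (depth (ssval v)) (isT : 0 < 3)) => [|[|[|]]] //; auto.
Qed.

End HistoryModel.

Section HaltingRun.
Variables (code : nat -> option instr) (final : history).
Hypothesis final_run : run code start final.

Let final_wf : well_formed final := run_well_formed final_run.

Implicit Types a b c d : history_model final.

Definition visited (h : history) : Prop := run code start h /\ run code h final.

Definition history_triple a b c : Prop :=
  [/\ visited (ssval a), pointer (ssval a) = Some (ssval b) &
    [\/ ssval c = start, step code (ssval a) (ssval c) /\ visited (ssval c)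
      | ssval a = final /\ ssval c = final]].

Lemma visited_start : visited start.
Proof. by split=> //; apply: rt_refl. Qed.

Lemma visited_final : visited final.
Proof. by split=> //; apply: rt_refl. Qed.

Lemma visited_next h : visited h -> h = final \/ exists2 u, step code h u & visited u.
Proof.
case=> start_h /run_first_step[|[u hu uf]]; [by left|right; exists u => //].
by split=> //; apply: rt_trans start_h (rt_step _ _ _ _ hu).
Qed.

Lemma visited_node h : visited h -> exists u : history_model final, ssval u = h.
Proof. by case=> _ /run_subhistories hf; exists (SeqSub hf). Qed.

Lemma visited_ptr a : visited (ssval a) -> exists b, pointer (ssval a) = Some (ssval b).
Proof.
case=> /run_node[l [k [p [c E]]]] _.
have cf : c \in subhistories final.
  by apply: subhistories_trans (ssvalP a) _; apply: subhistories_ptr; rewrite E.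
by exists (SeqSub cf); rewrite E.
Qed.

Lemma triple_start a : visited (ssval a) -> exists b c, history_triple a b c /\ startM c.
Proof.
move=> va; have [b ab] := visited_ptr va; have [c Ec] := visited_node visited_start.
by exists b, c; split=> //; split=> //; constructor 1.
Qed.

Hypothesis final_neq_start : final <> start.

Lemma triple_step a : visited (ssval a) -> exists b c, history_triple a b c /\ ~ startM c.
Proof.
move=> va; have [b ab] := visited_ptr va; exists b.
have [af|[u au vu]] := visited_next va.
  have [c Ec] := visited_node visited_final; exists c; rewrite start_history Ec.
  by split=> //; split=> //; constructor 3.
have [c Ec] := visited_node vu; exists c; rewrite start_history; rewrite -Ec in au vu.
split; first by split=> //; constructor 2.
by move=> E; rewrite E in au; apply: step_start au.
Qed.

Lemma triple_next a b c : history_triple a b c -> visited (ssval c).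
Proof. by case=> _ _ [->|[]|[_ ->]] //; [apply: visited_start|apply: visited_final]. Qed.

Lemma history_live : live history_triple.
Proof.
split=> a b c.
- by move=> /triple_next/triple_start[b' [c' [abc _]]]; exists b', c'.
- by case=> va _ _; apply: triple_start.
- by case=> va _ _; apply: triple_step.
Qed.

Variables (tags : seq nat) (forbidden n : nat).
Hypothesis final_label : node_label final = Some n.
Hypothesis final_halts : code n = None.
Hypothesis forbidden_halts : code forbidden = None.
Hypothesis final_allowed : n <> forbidden.

Lemma visited_label a : visited (ssval a) -> ~ labelM forbidden a.
Proof.
rewrite label_history => /visited_next[-> E|[u au _] E].
  by apply: final_allowed; move: E; rewrite final_label => -[].
by case: au E => l k p c i c' El _ [E]; rewrite E forbidden_halts in El.
Qed.

Lemma history_frame a b c d : history_triple a b c -> frameM tags forbidden a b d.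
Proof.
case=> va ab _; split; [|split; [|split]].
- split; first by move=> E; have := depth_ptr (node_well_formed final_wf a) ab; rewrite E ltnn.
  split; first exact/(ptr_history final_wf).
  by rewrite (ptr_history final_wf) ab => -[/val_inj].
- move=> /start_history E; rewrite E in ab; case: ab => Eb.
  rewrite label_history !tag_history (prev_history final_wf) E -Eb.
  by do 3!split=> //; case=> <-.
- exact: visited_label.
- by move=> k l _ _; rewrite !tag_history => -> ->.
Qed.

Lemma step_action l k p t i t' a b c d : ssval a = Node l k p t -> ssval b = t ->
  target (mov (act i t)) p t = Some t' ->
  ssval c = Node (goto (act i t)) (written (act i t)) (ssval a) t' ->
  actionM (act i t) a b c d.
Proof.
move=> Ea Eb Et Ec; rewrite /actionM label_history tag_history (ptr_history final_wf) Ec.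
split=> //; split=> // -[Ed]; rewrite {}Ed in Et.
by case: (mov _) Et => /=;
  rewrite ?(ptr_history final_wf) ?(prev_history final_wf) ?Ea ?Eb // => -[->].
Qed.

Lemma history_instr m i a b c d : code m = Some i -> history_triple a b c ->
  instrM m i a b c d.
Proof.
move=> Em [_ ab next] not_start; rewrite label_history => la.
case: next => [/start_history//|[ac _]|[af _]]; last first.
  by move: la; rewrite af final_label => -[E]; rewrite -E final_halts in Em.
have [l [k [p [t [j [t' [Ea Ej Et Ec]]]]]]] := stepP ac.
have Elm : l = m by move: la; rewrite Ea => -[].
have Eji : j = i by move: Ej; rewrite Elm Em => -[].
have Eb : ssval b = t by move: ab; rewrite Ea => -[].
rewrite {}Eji in Et Ec.
split; first by rewrite (prev_history final_wf) Ec => -[/val_inj].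
have := step_action d Ea Eb Et Ec; rewrite /branchM tag_history Eb /act.
by case: eqP.
Qed.

Lemma history_simulates : simulates code tags forbidden history_triple.
Proof.
split; [exact: history_live|by move=> *; apply: history_frame; eassumption|].
by move=> *; apply: history_instr; eassumption.
Qed.

End HaltingRun.

(** * While programs on history machines *)

Inductive com :=
| CMov of nat & nat
| CInc of nat & nat
| CSeq of com & com
| CWhile of nat & com.

Inductive exec : com -> (nat -> nat) -> (nat -> nat) -> Prop :=
| exec_mov x y g : exec (CMov x y) g (update g x (g y))
| exec_inc x y g : exec (CInc x y) g (update g x (g y).+1)
| exec_seq c1 c2 g1 g2 g3 : exec c1 g1 g2 -> exec c2 g2 g3 -> exec (CSeq c1 c2) g1 g3
| exec_stop y c g : g y = 0 -> exec (CWhile y c) g g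
| exec_loop y c n g1 g2 g3 : g1 y = n.+1 -> exec c (update g1 y n) g2 ->
    exec (CWhile y c) g2 g3 -> exec (CWhile y c) g1 g3.

Fixpoint value (h : history) : nat := if h is Node _ _ _ c then (value c).+1 else 0.

(* The content of register x is the value of the pointer of the latest node
   written with x.+1; nodes written with 0 leave all registers unchanged. *)
Fixpoint latest (x : nat) (h : history) : history :=
  if h is Node _ k p c then if k == x.+1 then c else latest x p else h.

Definition store_of (h : history) : nat -> nat := fun x => value (latest x h).

Lemma store_of_write n x p c : store_of (Node n x.+1 p c) = update (store_of p) x (value c).
Proof. by apply: funext => y; rewrite /store_of /update /= eqSS eq_sym; case: eqP. Qed.

Lemma store_of_skip n p c : store_of (Node n 0 p c) = store_of p.
Proof. by []. Qed.

Definition pc (l : nat) : nat := l.*2.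
Definition input_pc (j : nat) : nat := j.*2.+1.

(* Ends with the pointer at the latest value of register y: instructions b + 2
   and b + 3 search for it, starting from the node that called them. *)
Definition fetch (y b : nat) : seq instr :=
  [:: jump (Action 0 Stay (pc (b + 1)));
      jump (Action 0 Recall (pc (b + 2)));
      Instr y.+2 (Action 0 PtrOfPtr (pc (b + 4))) (Action 0 Stay (pc (b + 3)));
      Instr 0 (Action 0 Stay (pc (b + 4))) (Action 0 PrevOfPtr (pc (b + 2)))].

Definition branch_on (y b exit again : nat) : seq instr :=
  fetch y b ++ [:: Instr 0 (Action 0 Stay (pc exit)) (Action y.+1 PtrOfPtr (pc again))].

Fixpoint compile (b : nat) (c : com) : seq instr :=
  match c with
  | CMov x y => fetch y b ++ [:: jump (Action x.+1 Stay (pc (b + 5)))]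
  | CInc x y => fetch y b ++ [:: jump (Action 0 Stay (pc (b + 5)));
                                 jump (Action x.+1 Recall (pc (b + 6)))]
  | CSeq c1 c2 => let s := compile b c1 in s ++ compile (b + size s) c2
  | CWhile y c => let s := compile (b + 5) c in
      branch_on y b (b + (size s + 6)) (b + 5) ++ s ++ [:: jump (Action 0 Stay (pc b))]
  end.

Lemma size_compile_while b y c :
  size (compile b (CWhile y c)) = size (compile (b + 5) c) + 6.
Proof. by rewrite /= size_cat /= !addnS. Qed.

Definition input_instr (j : nat) : instr := jump (Action 0 Recall (input_pc j.+1)).
Definition input_end : instr := jump (Action 1 Stay (pc 0)).

(* The odd labels belong to an input phase, which sets register 0 to m./2. *)
Definition code (prog : seq instr) (m n : nat) : option instr :=
  if odd n then
    if n./2 < m then Some (input_instr n./2) else if n./2 == m then Some input_end else None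
  else onth prog n./2.

Section Execution.
Variables (prog : seq instr) (m : nat).
Notation run := (run (code prog m)).

Lemma code_pc l : code prog m (pc l) = onth prog l.
Proof. by rewrite /code odd_double doubleK. Qed.

Lemma code_input j : j < m -> code prog m (input_pc j) = Some (input_instr j).
Proof. by rewrite /code /= odd_double /= uphalf_double => ->. Qed.

Lemma code_input_end : code prog m (input_pc m) = Some input_end.
Proof. by rewrite /code /= odd_double /= uphalf_double ltnn eqxx. Qed.

Lemma run_instr n i k p c c' : code prog m n = Some i -> target (mov (act i c)) p c = Some c' ->
  run (Node n k p c) (Node (goto (act i c)) (written (act i c)) (Node n k p c) c').
Proof. by move=> En Ec'; apply: rt_step (Step k En Ec'). Qed.

Lemma run_jump n w mv n' k p c c' : code prog m n = Some (jump (Action w mv n')) ->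
  target mv p c = Some c' -> run (Node n k p c) (Node n' w (Node n k p c) c').
Proof.
move=> En Ec'; have E : act (jump (Action w mv n')) c = Action w mv n' by rewrite /act if_same.
by have := @run_instr n _ k p c c' En; rewrite E; apply.
Qed.

Definition placed (b : nat) (s : seq instr) : Prop :=
  forall l i, onth s l = Some i -> code prog m (pc (b + l)) = Some i.

Lemma placed_cat b s1 s2 : placed b (s1 ++ s2) -> placed b s1 /\ placed (b + size s1) s2.
Proof.
move=> pl; split=> l i Ei.
  by apply: pl; rewrite onth_cat -onthTE Ei.
by rewrite -addnA; apply: pl; rewrite onth_cat ltnNge leq_addr addKn.
Qed.

Lemma search_run y b u k p (h := Node (pc (b + 2)) k p u) : placed b (fetch y b) ->
  exists p', run h (Node (pc (b + 4)) 0 p' (latest y u)) /\ store_of p' = store_of h.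
Proof.
move=> pl; rewrite {}/h; elim: u k p => [e|n l q IHq c _] k p; set h := Node _ _ _ _.
  pose h3 := Node (pc (b + 3)) 0 h (Base e); exists h3; split=> //.
  apply: (rt_trans _ _ _ h3); last exact: (@run_instr _ _ 0 h (Base e) _ (pl 3 _ erefl)).
  exact: (@run_instr _ _ k p (Base e) _ (pl 2 _ erefl)).
have := @run_instr _ _ k p (Node n l q c) _ (pl 2 _ erefl).
rewrite /act /= eqSS; case: eqP => _ step2; first by exists h; split=> //; apply: step2.
pose h3 := Node (pc (b + 3)) 0 h (Node n l q c).
have [p' [found store_p']] := IHq 0 h3; exists p'; split=> //.
apply: rt_trans found; apply: (rt_trans _ _ _ h3); first exact: step2.
exact: (@run_instr _ _ 0 h (Node n l q c) _ (pl 3 _ erefl)).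
Qed.

Lemma fetch_run y b h : placed b (fetch y b) -> node_label h = Some (pc b) ->
  exists p, run h (Node (pc (b + 4)) 0 p (latest y h)) /\ store_of p = store_of h.
Proof.
case: h => // n k p c pl [->]; set h := Node _ _ _ _; pose h1 := Node (pc (b + 1)) 0 h c.
have [p' [found store_p']] := search_run h 0 h1 pl; exists p'; split=> //.
apply: rt_trans found; apply: (rt_trans _ _ _ h1).
  by have := pl 0 _ erefl; rewrite addn0 => /run_jump; apply.
exact: (run_jump 0 (pl 1 _ erefl)).
Qed.

Definition reaches (l : nat) (g : nat -> nat) (l' : nat) (g' : nat -> nat) : Prop :=
  forall h, node_label h = Some (pc l) -> store_of h = g ->
  exists h', [/\ run h h', node_label h' = Some (pc l') & store_of h' = g'].

Lemma reaches_trans l1 g1 l2 g2 l3 g3 :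
  reaches l1 g1 l2 g2 -> reaches l2 g2 l3 g3 -> reaches l1 g1 l3 g3.
Proof.
move=> r12 r23 h1 lh1 sh1; have [h2 [run12 lh2 sh2]] := r12 h1 lh1 sh1.
have [h3 [run23 lh3 sh3]] := r23 h2 lh2 sh2; exists h3; split=> //.
exact: rt_trans run12 run23.
Qed.

Lemma mov_reaches x y b g : placed b (compile b (CMov x y)) ->
  reaches b g (b + 5) (update g x (g y)).
Proof.
move=> /placed_cat[/fetch_run fetched /(_ 0 _ erefl) /= E4] h /fetched[p [run4 store_p]] sh.
rewrite addn0 in E4; eexists; split; [exact: rt_trans run4 (run_jump _ E4 erefl)|by []|].
by rewrite store_of_write store_of_skip store_p sh -[X in update _ _ X]/(store_of h y) sh.
Qed.

Lemma inc_reaches x y b g : placed b (compile b (CInc x y)) ->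
  reaches b g (b + 6) (update g x (g y).+1).
Proof.
move=> /placed_cat[/fetch_run fetched pl] h /fetched[p [run4 store_p]] sh.
have E4 := pl 0 _ erefl; have E5 := pl 1 _ erefl; rewrite /= addn0 in E4; rewrite -addnA in E5.
have run5 := run_jump 0 E4 erefl; have run6 := run_jump 0 E5 erefl.
eexists; split; [exact: rt_trans run4 (rt_trans _ _ _ _ _ (run5 _ _) (run6 _ _))|by []|].
by rewrite store_of_write !store_of_skip store_p sh -[value _]/(store_of h y).+1 sh.
Qed.

Lemma branch_on_reaches y b exit again g : placed b (branch_on y b exit again) ->
  if g y is n.+1 then reaches b g again (update g y n) else reaches b g exit g.
Proof.
move=> /placed_cat[/fetch_run fetched /(_ 0 _ erefl) /=]; rewrite addn0 => E4.
have run5 h : node_label h = Some (pc b) -> store_of h = g -> exists p, store_of p = g /\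
    if latest y h is Node _ _ _ c then run h (Node (pc again) y.+1 p c)
    else run h (Node (pc exit) 0 p (latest y h)).
  move=> /fetched[p [run4 store_p]] sh; exists (Node (pc (b + 4)) 0 p (latest y h)).
  split; first by rewrite store_of_skip store_p.
  have := fun c' => @run_instr _ _ 0 p (latest y h) c' E4.
  by case: (latest y h) run4 => [e|n k q c] run4 /(_ _ erefl); apply: rt_trans.
have value_y h : store_of h = g -> value (latest y h) = g y by move=> <-.
case Eg: (g y) => [|n] h lh sh; have [p [store_p]] := run5 h lh sh.
  move: (value_y h sh); rewrite Eg; case: (latest y h) => // e _ run_h.
  by eexists; split; first exact: run_h.
move: (value_y h sh); rewrite Eg; case: (latest y h) => //= _ _ _ c [<-] run_h.
by eexists; split; [exact: run_h|by []|rewrite store_of_write store_p].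
Qed.

Lemma jump_reaches l l' g : placed l [:: jump (Action 0 Stay (pc l'))] -> reaches l g l' g.
Proof.
move=> /(_ 0 _ erefl); rewrite addn0 => El [//|n k p c] [->] sh.
by eexists; split; [exact: (run_jump _ El erefl)|by []|rewrite store_of_skip].
Qed.

Lemma compile_reaches c g g' : exec c g g' ->
  forall b, placed b (compile b c) -> reaches b g (b + size (compile b c)) g'.
Proof.
elim=> {c g g'} [x y g|x y g|c1 c2 g1 g2 g3 _ IH1 _ IH2|y c g g0|y c n g1 g2 g3 gn _ IH1 _ IH2] b.
- exact: mov_reaches.
- exact: inc_reaches.
- move=> /placed_cat[p1 p2] /=; rewrite size_cat addnA.
  exact: reaches_trans (IH1 b p1) (IH2 _ p2).
- move=> /placed_cat[test _]; have := branch_on_reaches g test.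
  by rewrite g0 size_compile_while.
move=> /[dup] /IH2 r23 /placed_cat[test /placed_cat[body /jump_reaches back]].
have := branch_on_reaches g1 test; rewrite gn => r1.
apply: reaches_trans r23; apply: reaches_trans r1 _.
by apply: reaches_trans (IH1 _ body) _; apply: back.
Qed.

(* Node number j of the input phase points to node number j - 2. *)
Lemma input_run : exists h, [/\ run start h, node_label h = Some (pc 0) &
  store_of h = update (fun=> 0) 0 m./2].
Proof.
have phase j : j <= m -> exists p c, let h := Node (input_pc j) 0 p c in
    [/\ run start h, value c = j./2, value p = uphalf j & store_of h = (fun=> 0)].
  elim: j => [|j IHj] jm.
    exists (Base true), (Base false); split=> //; exact: rt_refl.
  have [p [c [run_j vc vp store_j]]] := IHj (ltnW jm).
  exists (Node (input_pc j) 0 p c), p; split=> //=; last by rewrite vc.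
  by apply: rt_trans run_j _; apply: run_jump (code_input jm) _.
have [p [c [run_m vc _ store_m]]] := phase m (leqnn m).
exists (Node (pc 0) 1 (Node (input_pc m) 0 p c) c); split=> //.
  by apply: rt_trans run_m _; apply: run_jump code_input_end _.
by rewrite store_of_write store_m vc.
Qed.

End Execution.

Definition halt_pc (prog : seq instr) : nat := pc (size prog).
Definition forbidden_pc (prog : seq instr) : nat := pc (size prog).+1.

Definition test_program (c : com) : seq instr :=
  let s := compile 0 c in
  s ++ branch_on 1 (size s) (size s + 5) (size s + 6).

Lemma test_program_run c m g (prog := test_program c) :
  exec c (update (fun=> 0) 0 m./2) g -> exists2 h, run (code prog m) start h &
  node_label h = Some (if g 1 == 0 then halt_pc prog else forbidden_pc prog).
Proof.
move=> cg; have [h0 [run0 lh0 sh0]] := input_run prog m.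
have pl : placed prog m 0 prog by move=> l i; rewrite code_pc.
have [/(compile_reaches cg) reach_c /(branch_on_reaches g) test] := placed_cat pl.
have [h1 [run1 lh1 sh1]] := reach_c h0 lh0 sh0.
have size_prog : size prog = size (compile 0 c) + 5 by rewrite size_cat.
rewrite /halt_pc /forbidden_pc size_prog -addnS.
case: (g 1) test => [|n] /(_ h1 lh1 sh1)[h2 [run2 lh2 _]]; exists h2 => //;
  exact: rt_trans run0 (rt_trans _ _ _ _ _ run1 run2).
Qed.

(** * Partial recursive functions as while programs *)

(* Reads the registers args, writes the register out, and uses the registers
   from fresh on as scratch space. *)
Definition generator (n : nat) : Type := n.-tuple nat -> nat -> nat -> com.

Definition agree_below (fresh : nat) (g h : nat -> nat) : Prop :=
  forall x, x < fresh -> h x = g x.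

Definition implements n (C : generator n) (R : n.-tuple nat -> nat -> Prop) : Prop :=
  forall (args : n.-tuple nat) out fresh g r, all (gtn fresh) args -> out < fresh ->
  R [tuple of map g args] r -> exists h,
  [/\ exec (C args out fresh) g h, h out = r & forall x, x < fresh -> x <> out -> h x = g x].

Definition skip : com := CMov 0 0.

Lemma exec_skip g : exec skip g g.
Proof.
have {2}-> : g = update g 0 (g 0) by apply: funext => -[].
exact: exec_mov.
Qed.

Lemma exec_while_count y c (I : nat -> (nat -> nat) -> Prop) n g :
  (forall k h, k < n -> I k h ->
    exists j h', [/\ h y = j.+1, exec c (update h y j) h' & I k.+1 h']) ->
  (forall h, I n h -> h y = 0) -> I 0 g ->
  exists2 h, exec (CWhile y c) g h & I n h.
Proof.
elim: n I g => [|n IHn] I g body exit I0; first by exists g => //; apply/exec_stop/exit.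
have [j [g1 [gy cg1 I1]]] := body 0 g isT I0.
have [||//|h loop In] := IHn (fun k => I k.+1) g1 => [k h kn|h /exit //|].
  exact: body.
by exists h => //; apply: exec_loop gy cg1 loop.
Qed.

Definition clear (x : nat) : com := CWhile x skip.

Lemma exec_clear x g : exec (clear x) g (update g x 0).
Proof.
pose I k h := h = update g x (g x - k).
have [k h lt_k ->|h ->||h loop Ih] := @exec_while_count x skip I (g x) g.
- exists (g x - k.+1), (update g x (g x - k.+1)).
  split=> //; first by rewrite update_same subnSK.
  have -> : update (update g x (g x - k)) x (g x - k.+1) = update g x (g x - k.+1).
    by apply: funext => z; rewrite /update; case: eqP.
  exact: exec_skip.
- by rewrite update_same subnn.
- by apply: funext => z; rewrite /update subn0; case: eqP => // ->.
by rewrite Ih subnn in loop.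
Qed.

Lemma map_agree_below n (args : n.-tuple nat) fresh g h : all (gtn fresh) args ->
  agree_below fresh g h -> [tuple of map h args] = [tuple of map g args].
Proof.
by move=> /allP lt gh; apply: val_inj; apply/eq_in_map => x /lt; apply: gh.
Qed.

Lemma all_gtn_trans m n (s : seq nat) : m <= n -> all (gtn m) s -> all (gtn n) s.
Proof. by move=> mn; apply: sub_all => x xm; apply: leq_trans xm mn. Qed.

Lemma implements_zero n : @implements n (fun _ out _ => clear out) (fun _ r => r = 0).
Proof.
move=> args out fresh g _ _ _ ->; exists (update g out 0); split; first exact: exec_clear.
  exact: update_same.
by move=> x _; apply: update_other.
Qed.

Lemma implements_succ :
  @implements 1 (fun args out _ => CInc out (thead args)) (fun v r => r = (thead v).+1).
Proof.
move=> args out fresh g _ _ _ ->; exists (update g out (g (thead args)).+1).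
split; [exact: exec_inc|by rewrite update_same /thead tnth_map|].
by move=> x _; apply: update_other.
Qed.

Lemma implements_proj n (i : 'I_n) :
  implements (fun args out _ => CMov out (tnth args i)) (fun v r => r = tnth v i).
Proof.
move=> args out fresh g _ _ _ ->; exists (update g out (g (tnth args i))).
split; [exact: exec_mov|by rewrite update_same tnth_map|].
by move=> x _; apply: update_other.
Qed.

Section Composition.
Variables (n m : nat) (C : generator m) (D : 'I_m -> generator n).
Variables (R : m.-tuple nat -> nat -> Prop) (S : 'I_m -> n.-tuple nat -> nat -> Prop).
Hypotheses (CR : implements C R) (DS : forall i, implements (D i) (S i)).

Definition args_com (args : n.-tuple nat) (fresh : nat) (s : seq 'I_m) : com :=
  foldr CSeq skip [seq D i args (fresh + i) (fresh + m) | i <- s].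

Definition comp_com : generator n := fun args out fresh =>
  CSeq (args_com args fresh (enum 'I_m)) (C [tuple fresh + i | i < m] out (fresh + m)).

Lemma exec_args (args : n.-tuple nat) fresh g (w : m.-tuple nat) s :
  all (gtn fresh) args -> uniq s -> (forall i, S i [tuple of map g args] (tnth w i)) ->
  exists h, [/\ exec (args_com args fresh s) g h, agree_below fresh g h &
    forall i : 'I_m, h (fresh + i) = if i \in s then tnth w i else g (fresh + i)].
Proof.
move=> lt_args; elim: s g => [|i s IHs] g; first by exists g; split=> //; apply: exec_skip.
move=> /andP[i_s uniq_s] Sw.
have lt_args' := all_gtn_trans (leq_addr m fresh) lt_args.
have [|g1 [Dg1 g1i g1E]] := DS lt_args' (out := fresh + i) _ (Sw i); first by rewrite ltn_add2l.
have gg1 : agree_below fresh g g1.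
  by move=> x lt_x; apply: g1E => [|E]; [apply: ltn_addr|rewrite E ltnNge leq_addr in lt_x].
have [//|h [sh g1h hE]] := IHs g1 uniq_s; first by rewrite (map_agree_below lt_args gg1).
exists h; split; [exact: exec_seq Dg1 sh|by move=> x lt_x; rewrite g1h ?gg1|] => j.
rewrite hE inE; case: eqP => [->|ne_ji] /=; first by rewrite (negPf i_s).
by case: ifP => // _; apply: g1E => [|/addnI/val_inj//]; rewrite ltn_add2l.
Qed.

Lemma implements_comp :
  implements comp_com (fun v r => exists2 w : m.-tuple nat, forall i, S i v (tnth w i) & R w r).
Proof.
move=> args out fresh g r lt_args lt_out [w Sw Rw].
have [h [args_h gh hE]] := exec_args lt_args (enum_uniq 'I_m) Sw.
have hw : [tuple of map h [tuple fresh + i | i < m]] = w.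
  by apply: eq_from_tnth => i; rewrite tnth_map tnth_mktuple hE mem_enum.
have [|||h' [Ch' h'out h'E]] := CR (args := [tuple fresh + i | i < m]) (out := out)
  (fresh := fresh + m) (g := h) (r := r).
- by apply/allP => _ /mapP[i _ ->]; rewrite /= ltn_add2l.
- exact: ltn_addr.
- by rewrite hw.
exists h'; split=> //; first exact: exec_seq args_h Ch'.
by move=> x lt_x ne_x; rewrite h'E ?gh //; apply: ltn_addr.
Qed.

End Composition.

Section PrimitiveRecursion.
Variables (n : nat) (C : generator n) (D : generator n.+2).
Variables (R : n.-tuple nat -> nat -> Prop) (S : n.+2.-tuple nat -> nat -> Prop).
Hypotheses (CR : implements C R) (DS : implements D S).

Definition prim_iter (p : n.-tuple nat) : nat -> nat -> Prop :=
  fix iter k r := match k with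
    | 0 => R p r
    | j.+1 => exists2 q, iter j q & S [tuple of j :: q :: p] r
    end.

Lemma prim_iter_trace p k r : prim_iter p k r -> exists t : nat -> nat,
  [/\ R p (t 0), forall j, j < k -> S [tuple of j :: t j :: p] (t j.+1) & t k = r].
Proof.
elim: k r => [|k IHk] r /=; first by exists (fun=> r).
case=> q /IHk[t [Rt St tk]] Sq; exists (update t k.+1 r); split=> [//|j|].
  rewrite ltnS leq_eqVlt => /predU1P[->|lt_jk].
    by rewrite update_same update_other ?tk //; lia.
  by rewrite !update_other; [apply: St|lia|lia].
exact: update_same.
Qed.

(* Scratch registers: the number of iterations left, the number of iterations
   done, the current value and the next value. *)
Definition prim_body (params : n.-tuple nat) (fresh : nat) : com :=
  CSeq (D [tuple of fresh.+1 :: fresh.+2 :: params] fresh.+3 fresh.+4)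
       (CSeq (CMov fresh.+2 fresh.+3) (CInc fresh.+1 fresh.+1)).

Definition prim_com : generator n.+1 := fun args out fresh =>
  let params := [tuple of behead args] in
  CSeq (CMov fresh (thead args)) (CSeq (clear fresh.+1) (CSeq (C params fresh.+2 fresh.+4)
    (CSeq (CWhile fresh (prim_body params fresh)) (CMov out fresh.+2)))).

Lemma exec_prim_body (params : n.-tuple nat) fresh r (h : nat -> nat) : all (gtn fresh) params ->
  S [tuple of h fresh.+1 :: h fresh.+2 :: [tuple of map h params]] r ->
  exists h', [/\ exec (prim_body params fresh) h h', h' fresh = h fresh,
    h' fresh.+1 = (h fresh.+1).+1, h' fresh.+2 = r & agree_below fresh h h'].
Proof.
move=> lt_params Sr.
have [|||h1 [Dh1 h1tmp h1E]] := DS (out := fresh.+3) (fresh := fresh.+4) (g := h) (r := r)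
  (args := [tuple of fresh.+1 :: fresh.+2 :: params]).
- by rewrite /= (all_gtn_trans (leq_addl 4 fresh)) //; lia.
- exact: leqnn.
- by move: Sr; congr S; apply: val_inj.
pose h2 := update h1 fresh.+2 (h1 fresh.+3).
exists (update h2 fresh.+1 (h2 fresh.+1).+1); split; rewrite /h2.
- exact: exec_seq Dh1 (exec_seq (exec_mov _ _ _) (exec_inc _ _ _)).
- by rewrite !update_other ?h1E //; lia.
- by rewrite update_same update_other ?h1E //; lia.
- by rewrite update_other ?update_same //; lia.
- by move=> x lt_x; rewrite !update_other ?h1E //; lia.
Qed.

Lemma implements_prim :
  implements prim_com (fun v r => prim_iter [tuple of behead v] (thead v) r).
Proof.
move=> args out fresh g r lt_args lt_out.
set params := [tuple of behead args].
have -> : thead [tuple of map g args] = g (thead args) by rewrite /thead tnth_map.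
have -> : [tuple of behead [tuple of map g args]] = [tuple of map g params].
  by apply: val_inj; rewrite /= behead_map.
have lt_params : all (gtn fresh) params by apply/allP => x /mem_behead/(allP lt_args).
set N := g (thead args) => /prim_iter_trace[t [Rt St tN]].
pose g1 := update (update g fresh N) fresh.+1 0.
have gg1 : agree_below fresh g g1 by move=> x lt_x; rewrite /g1 !update_other //; lia.
have [|||g2 [Cg2 g2acc g2E]] := CR (args := params) (out := fresh.+2) (fresh := fresh.+4)
  (r := t 0) (g := g1).
- exact: all_gtn_trans (leq_addl 4 fresh) lt_params.
- by lia.
- by rewrite (map_agree_below lt_params gg1).
pose I k h := [/\ h fresh = N - k, h fresh.+1 = k, h fresh.+2 = t k & agree_below fresh g h].
have [k h lt_k [hcnt hidx hacc gh]|h []||h loop [_ _ hacc gh]] :=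
  @exec_while_count fresh (prim_body params fresh) I N g2.
- pose h1 := update h fresh (N - k.+1).
  have gh1 : agree_below fresh g h1 by move=> x lt_x; rewrite /h1 update_other ?gh //; lia.
  have [||h2 [body h2cnt h2idx h2acc h12]] := @exec_prim_body params fresh (t k.+1) h1 => //.
    rewrite (map_agree_below lt_params gh1) /h1 !update_other ?hidx ?hacc; [|lia|lia].
    exact: St.
  exists (N - k.+1), h2; split=> //; first by rewrite hcnt; lia.
  split=> //; first by rewrite h2cnt /h1 update_same.
    by rewrite h2idx /h1 update_other ?hidx //; lia.
  by move=> x lt_x; rewrite h12 ?gh1.
- by rewrite subnn.
- split=> //; last by move=> x lt_x; rewrite g2E ?gg1 //; lia.
    by rewrite g2E /g1 1?update_other ?update_same ?subn0 //; lia.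
  by rewrite g2E /g1 ?update_same //; lia.
exists (update h out (h fresh.+2)); split; [|by rewrite update_same hacc|].
  apply: exec_seq (exec_mov _ _ _) (exec_seq (exec_clear _ _) _).
  exact: exec_seq Cg2 (exec_seq loop (exec_mov _ _ _)).
by move=> x lt_x ne_x; rewrite update_other ?gh.
Qed.

End PrimitiveRecursion.

Section Minimization.
Variables (n : nat) (C : generator n.+1) (R : n.+1.-tuple nat -> nat -> Prop).
Hypothesis CR : implements C R.

Definition mu_rel (v : n.-tuple nat) (r : nat) : Prop :=
  R [tuple of r :: v] 0 /\ forall k, k < r -> exists q, R [tuple of k :: v] q.+1.

Lemma mu_trace v r : mu_rel v r -> exists t : nat -> nat,
  forall k, k <= r -> R [tuple of k :: v] (t k) /\ (0 < t k) = (k < r).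
Proof.
case=> R0 RS.
have /choice[t tP] k : exists q, k <= r -> R [tuple of k :: v] q /\ (0 < q) = (k < r).
  have [lt_kr|lt_rk|->] := ltngtP k r; [|by exists 0|by exists 0].
  by have [q Rq] := RS k lt_kr; exists q.+1.
by exists t.
Qed.

Definition mu_test (args : n.-tuple nat) (fresh : nat) : com :=
  C [tuple of fresh :: args] fresh.+1 fresh.+2.

Definition mu_com : generator n := fun args out fresh =>
  CSeq (clear fresh) (CSeq (mu_test args fresh)
    (CSeq (CWhile fresh.+1 (CSeq (CInc fresh fresh) (mu_test args fresh))) (CMov out fresh))).

Lemma exec_mu_test (args : n.-tuple nat) fresh (g : nat -> nat) q : all (gtn fresh) args ->
  R [tuple of g fresh :: [tuple of map g args]] q ->
  exists h, [/\ exec (mu_test args fresh) g h, h fresh = g fresh, h fresh.+1 = q &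
    agree_below fresh g h].
Proof.
move=> lt_args Rq; have [|||h [Ch htst hE]] := CR (out := fresh.+1) (fresh := fresh.+2)
  (g := g) (r := q) (args := [tuple of fresh :: args]).
- by rewrite /= leqnSn (all_gtn_trans (leq_addl 2 fresh)).
- exact: leqnn.
- by move: Rq; congr R; apply: val_inj.
exists h; split=> // [|x lt_x]; first by rewrite hE //; lia.
by rewrite hE //; lia.
Qed.

Lemma implements_mu : implements mu_com mu_rel.
Proof.
move=> args out fresh g r lt_args lt_out /mu_trace[t tP].
pose I k h := [/\ h fresh = k, h fresh.+1 = t k & agree_below fresh g h].
have test k h : k <= r -> h fresh = k -> agree_below fresh g h ->
    exists2 h', exec (mu_test args fresh) h h' & I k h'.
  move=> le_kr hidx gh; have [|h' [Ch' h'idx h'tst hh']] := @exec_mu_test _ _ h (t k) lt_args.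
    by rewrite hidx (map_agree_below lt_args gh); apply: (tP k le_kr).1.
  by exists h' => //; split; [rewrite h'idx| |move=> x lt_x; rewrite hh' ?gh].
have [|x lt_x|g1 Cg1 I0] := @test 0 (update g fresh 0) (leq0n r).
- exact: update_same.
- by rewrite update_other //; lia.
have [k h lt_kr [hidx htst gh]|h [_ -> _]|//|h loop [hidx _ gh]] :=
  @exec_while_count fresh.+1 (CSeq (CInc fresh fresh) (mu_test args fresh)) I r g1.
- have := (tP k (ltnW lt_kr)).2; rewrite lt_kr -htst; case Ej: (h fresh.+1) => [|j] // _.
  pose h1 := update h fresh.+1 j; exists j.
  have [||h2 Ch2 Ih2] := @test k.+1 (update h1 fresh (h1 fresh).+1) lt_kr.
  + by rewrite update_same /h1 update_other ?hidx //; lia.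
  + by move=> x lt_x; rewrite /h1 !update_other ?gh //; lia.
  by exists h2; split=> //; apply: exec_seq (exec_inc _ _ _) Ch2.
- by have := (tP r (leqnn r)).2; rewrite ltnn; case: (t r).
exists (update h out (h fresh)); split.
- exact: exec_seq (exec_clear _ _) (exec_seq Cg1 (exec_seq loop (exec_mov _ _ _))).
- by rewrite update_same.
- by move=> x lt_x ne_x; rewrite update_other ?gh.
Qed.

End Minimization.

Fixpoint com_of_recf n (f : recf n) : generator n :=
  match f in recf n return generator n with
  | Zero _ => fun _ out _ => clear out
  | Succ => fun args out _ => CInc out (thead args)
  | Proj _ i => fun args out _ => CMov out (tnth args i)
  | Comp _ _ f g => comp_com (com_of_recf f) (fun i => com_of_recf (g i))
  | PrimRec _ f g => prim_com (com_of_recf f) (com_of_recf g)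
  | Mu _ f => mu_com (com_of_recf f)
  end.

Lemma com_of_recf_implements n (f : recf n) : implements (com_of_recf f) (sem f).
Proof.
elim: f => {n} [n||n i|n m f IHf g IHg|n f IHf g IHg|n f IHf].
- exact: implements_zero.
- exact: implements_succ.
- exact: implements_proj.
- exact: implements_comp IHf IHg.
- exact: implements_prim IHf IHg.
- exact: implements_mu IHf.
Qed.

(** * The formula of a program and its input *)

Fixpoint progF (l : nat) (prog : seq instr) : tau_formula :=
  if prog is i :: s then And (instrF (pc l) i) (progF l.+1 s) else topF.

Fixpoint inputF (m : nat) : tau_formula :=
  if m is j.+1 then And (inputF j) (instrF (input_pc j) (input_instr j)) else topF.

Definition input_phaseF (m : nat) : tau_formula :=
  And (inputF m) (instrF (input_pc m) input_end).

Definition prog_tags (prog : seq instr) : seq nat := [:: 0; 1; 2] ++ flatten (map instr_tags prog).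

Definition program_phaseF (prog : seq instr) : tau_formula :=
  And (frameF (prog_tags prog) (forbidden_pc prog)) (progF 0 prog).

Definition machineF (prog : seq instr) : tau_formula := coreF (program_phaseF prog).

Definition runF (prog : seq instr) (m : nat) : tau_formula :=
  prefixed (And (machineF prog) (input_phaseF m)).

Lemma fo_matrix_input_phaseF m : fo_matrix (input_phaseF m).
Proof.
rewrite fo_matrix_And fo_matrix_instrF andbT; elim: m => //= m IHm.
by rewrite fo_matrix_And IHm fo_matrix_instrF.
Qed.

Lemma fo_matrix_program_phaseF prog : fo_matrix (program_phaseF prog).
Proof.
rewrite fo_matrix_And fo_matrix_frameF /=.
by elim: prog 0 => //= i s IHs l; rewrite fo_matrix_And fo_matrix_instrF IHs.
Qed.

Lemma runF_E3A prog m : E3A_sentence (runF prog m).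
Proof.
have /and3P[_ qp vp] := fo_matrix_program_phaseF prog.
have /and3P[_ qi vi] := fo_matrix_input_phaseF m.
apply: prefixed_E3A; first exact/andP.
by rewrite /= all_cat vi andbT.
Qed.

Lemma code_tags prog m n i :
  code prog m n = Some i -> {subset instr_tags i <= prog_tags prog}.
Proof.
rewrite /code; case: ifP => _ Ei; last first.
  move=> k k_tags; rewrite /prog_tags mem_cat orbC; apply/orP; left.
  by apply/flattenP; exists (instr_tags i) => //; apply/onthP; exists n./2; rewrite onth_map Ei.
by case: ifP Ei => [_|_]; [|case: ifP => // _]; case=> <- k; rewrite !inE => /or3P[] /eqP ->.
Qed.

Section Evaluation.
Variables (M : structure tau_bin_un) (prog : seq instr) (m : nat).
Implicit Types a b c d : M.

Lemma eval_progF a b c d l s : eval (env a b c d) (progF l s) <->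
  forall j i, onth s j = Some i -> instrM (pc (l + j)) i a b c d.
Proof.
elim: s l => [|i s IHs] l; first by split=> // _ [].
rewrite eval_And eval_instrF IHs; split=> [[h0 h] [|j] i' /=|h].
- by case=> <-; rewrite addn0.
- by rewrite -addSnnS; apply: h.
- split=> [|j i' Ej]; first by have := h 0 i erefl; rewrite addn0.
  by rewrite addSnnS; apply: h.
Qed.

Lemma eval_inputF a b c d : eval (env a b c d) (inputF m) <->
  forall j, j < m -> instrM (input_pc j) (input_instr j) a b c d.
Proof.
elim: m => [|k IHk]; first by split.
rewrite eval_And IHk eval_instrF; split=> [[h hk] j|h].
  by rewrite ltnS leq_eqVlt => /predU1P[->|/h].
by split=> [j /ltnW/h//|]; apply: h.
Qed.

Lemma eval_code a b c d :
  eval (env a b c d) (And (progF 0 prog) (input_phaseF m)) <->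
  forall n i, code prog m n = Some i -> instrM n i a b c d.
Proof.
rewrite eval_And eval_progF eval_And eval_inputF eval_instrF; split=> [[hp [hi he]] n i|h].
  rewrite -[n in instrM n](odd_double_half n) /code; case: (odd n) => /=; last first.
    by rewrite add0n; apply: hp.
  by case: ltngtP => // [lt_nm|->] [<-]; [apply: hi|apply: he].
split=> [l i Ei|]; first by apply: h; rewrite code_pc.
by split=> [j lt_jm|]; apply: h; [apply: code_input|apply: code_input_end].
Qed.

Lemma true_runF : true_in M (runF prog m) <-> exists T, (exists a b c, T a b c) /\
  simulates (M := M) (code prog m) (prog_tags prog) (forbidden_pc prog) T.
Proof.
pose chi := And (program_phaseF prog) (input_phaseF m).
have mchi : fo_matrix chi.
  by rewrite fo_matrix_And fo_matrix_program_phaseF fo_matrix_input_phaseF.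
have chiE a b c d : eval (env a b c d) chi <->
    frameM (prog_tags prog) (forbidden_pc prog) a b d /\
    forall n i, code prog m n = Some i -> instrM n i a b c d.
  by rewrite -eval_code -(eval_frameF a b c d) !eval_And; tauto.
have chi_neq a b c d : eval (env a b c d) chi -> a <> b.
  by move=> /chiE[[[]]].
rewrite /runF true_prefixed; split=> -[T [T0 hT]]; exists T; split=> //.
  have /(holds_coreF T mchi chi_neq)[T_live T_chi] : holds (triples T) (coreF chi).
    by move: hT; rewrite /machineF /coreF /chi /=; tauto.
  by split=> // [a b c d /(T_chi _ _ _ d)/chiE[]|n i a b c d En /(T_chi _ _ _ d)/chiE[_]]; auto.
have : holds (triples T) (coreF chi).
  apply/(holds_coreF T mchi chi_neq); split; first exact: sim_live hT.
  move=> a b c d Tabc; apply/chiE; split; first exact: sim_frame hT _ _ _ _ Tabc.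
  by move=> n i En; apply: sim_instr hT _ _ _ _ _ _ En Tabc.
by rewrite /machineF /coreF /chi /=; tauto.
Qed.

End Evaluation.

Lemma forbidden_unsatisfiable prog m h : run (code prog m) start h ->
  node_label h = Some (forbidden_pc prog) -> ~ satisfiable (runF prog m).
Proof.
move=> start_h lh [M /true_runF[T [T0 sim]]].
exact: (run_avoids_forbidden _ _ (@code_tags prog m) sim T0 start_h lh).
Qed.

Lemma code_out prog m l : size prog <= l -> code prog m (pc l) = None.
Proof. by move=> le_l; rewrite code_pc onth_default. Qed.

Lemma halting_finitely_satisfiable prog m h : run (code prog m) start h ->
  node_label h = Some (halt_pc prog) -> finitely_satisfiable (runF prog m).
Proof.
move=> start_h lh; exists (history_model h); split; first exact: history_model_finite.
apply/true_runF; exists (@history_triple (code prog m) h); split.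
  have [a Ea] := visited_node (visited_final start_h).
  have [|b [c [abc _]]] := triple_start start_h (a := a).
    by rewrite Ea; apply: visited_final.
  by exists a, b, c.
apply: (history_simulates start_h _ _ lh).
- by move=> E; move: lh; rewrite E => -[/(congr1 odd)]; rewrite /halt_pc odd_double.
- exact: code_out.
- by apply: code_out; apply: leqnSn.
- by move=> /double_inj; lia.
Qed.

(** * Computability of the reduction *)

Definition computable n (F : n.-tuple nat -> nat) : Prop :=
  exists f : recf n, forall v, sem f v (F v).

Definition computable1 (F : nat -> nat) : Prop := computable (fun v : 1.-tuple nat => F (thead v)).

Lemma computable_comp n m (H : m.-tuple nat -> nat) (F : 'I_m -> n.-tuple nat -> nat) :
  computable H -> (forall i, computable (F i)) ->
  computable (fun v => H [tuple F i v | i < m]).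
Proof.
move=> [h hP] /choice[f fP]; exists (Comp h f) => v.
by exists [tuple F i v | i < m] => [i|]; rewrite ?tnth_mktuple; auto.
Qed.

Lemma computable_comp1 n (H : nat -> nat) (F : n.-tuple nat -> nat) :
  computable1 H -> computable F -> computable (fun v => H (F v)).
Proof.
move=> cH cF; have [f fP] := computable_comp cH (fun _ : 'I_1 => cF); exists f => v.
by have := fP v; rewrite /thead tnth_mktuple.
Qed.

Lemma computable_succ n (F : n.-tuple nat -> nat) :
  computable F -> computable (fun v => (F v).+1).
Proof. by apply: computable_comp1; exists Succ. Qed.

Lemma computable_const n k : computable (fun _ : n.-tuple nat => k).
Proof. by elim: k => [|k]; [exists (Zero n)|apply: computable_succ]. Qed.

Lemma computable_proj n (i : 'I_n) : computable (fun v => tnth v i).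
Proof. by exists (Proj i). Qed.

Lemma computable_rec n (F : n.-tuple nat -> nat) (G : n.+2.-tuple nat -> nat)
    (H : nat -> n.-tuple nat -> nat) :
  computable F -> computable G -> (forall p, H 0 p = F p) ->
  (forall k p, H k.+1 p = G [tuple of k :: H k p :: p]) ->
  computable (fun v : n.+1.-tuple nat => H (thead v) [tuple of behead v]).
Proof.
move=> [f fP] [g gP] H0 HS; exists (PrimRec f g) => v /=.
elim: (thead v) => [|k IHk]; first by rewrite H0.
by exists (H k [tuple of behead v]) => //; rewrite HS.
Qed.

Lemma computable_rec1 (c : nat) (G : 2.-tuple nat -> nat) (H : nat -> nat) :
  computable G -> H 0 = c -> (forall k, H k.+1 = G [tuple k; H k]) -> computable1 H.
Proof.
move=> cG H0 HS; apply: (computable_rec (F := fun=> c) (G := G) (H := fun k _ => H k)) => //.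
  exact: computable_const.
by move=> k p; rewrite HS; congr G; apply: val_inj; rewrite /= (tuple0 p).
Qed.

Lemma computable_double n (F : n.-tuple nat -> nat) :
  computable F -> computable (fun v => (F v).*2).
Proof.
apply: computable_comp1; apply: (@computable_rec1 0 (fun v => (tnth v ord_max).+2)) => //.
by do 2!apply: computable_succ; apply: computable_proj.
Qed.

Lemma computable_code_cons n (F : n.-tuple nat -> nat) (s : n.-tuple nat -> seq nat) :
  computable F -> computable (fun v => CodeSeq.code (s v)) ->
  computable (fun v => CodeSeq.code (F v :: s v)).
Proof.
move=> cF cs; pose H k (p : 1.-tuple nat) := 2 ^ k * (thead p).*2.+1.
have cH : computable (fun v : 2.-tuple nat => H (thead v) [tuple of behead v]).
  apply: (computable_rec (F := fun p => (thead p).*2.+1)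
      (G := fun v : 3.-tuple nat => (tnth v (inord 1)).*2)).
  - by apply/computable_succ/computable_double/computable_proj.
  - by apply/computable_double/computable_proj.
  - by move=> p; rewrite /H mul1n.
  - by move=> k p; rewrite /H (tnth_nth 0) /= inordK // expnS -mulnA mul2n.
pose G (i : 'I_2) := if i == ord0 then F else fun v => CodeSeq.code (s v).
have cG i : computable (G i) by rewrite /G; case: ifP.
have [f fP] := computable_comp cH cG; exists f => v; have := fP v.
rewrite (_ : [tuple G i v | i < 2] = [tuple F v; CodeSeq.code (s v)]) //.
by apply: eq_from_tnth => -[[|[|]] // ?]; rewrite tnth_mktuple.
Qed.

Definition computableF n (phi : n.-tuple nat -> tau_formula) : Prop :=
  computable (fun v => formula_code (phi v)).

Lemma computableF_const n phi : computableF (fun _ : n.-tuple nat => phi).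
Proof. exact: computable_const. Qed.

Lemma computable_code3 n k (F G : n.-tuple nat -> nat) :
  computable F -> computable G -> computable (fun v => CodeSeq.code [:: k; F v; G v]).
Proof.
move=> cF cG; apply: computable_code_cons; first exact: computable_const.
apply: computable_code_cons => //; apply: computable_code_cons => //.
exact: computable_const.
Qed.

Lemma computableF_And n (phi psi : n.-tuple nat -> tau_formula) :
  computableF phi -> computableF psi -> computableF (fun v => And (phi v) (psi v)).
Proof. exact: computable_code3. Qed.

Lemma computableF_Or n (phi psi : n.-tuple nat -> tau_formula) :
  computableF phi -> computableF psi -> computableF (fun v => Or (phi v) (psi v)).
Proof. exact: computable_code3. Qed.

Lemma computableF_mark n (K : n.-tuple nat -> nat) x :
  computable K -> computableF (fun v => markF (K v) x).
Proof.
move=> cK; apply: (@computable_code3 _ 2 (fun v => (K v).+1) (fun=> x)).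
  exact: computable_succ.
exact: computable_const.
Qed.

Lemma computableF_neg_mark n (K : n.-tuple nat -> nat) x :
  computable K -> computableF (fun v => neg (markF (K v) x)).
Proof.
move=> cK; apply: (@computable_code3 _ 3 (fun v => (K v).+1) (fun=> x)).
  exact: computable_succ.
exact: computable_const.
Qed.

Lemma computable_label n (L : n.-tuple nat -> nat) :
  computable L -> computable (fun v => (L v).*2.+4).
Proof. by move=> cL; do 4!apply: computable_succ; apply: computable_double. Qed.

Lemma computableF_action n (L : n.-tuple nat -> nat) w mv :
  computable L -> computableF (fun v => actionF (Action w mv (L v))).
Proof.
move=> cL; rewrite /actionF /=; apply: computableF_And; last exact: computableF_const.
exact/computableF_mark/computable_label.
Qed.

Lemma computableF_jump n (K L : n.-tuple nat -> nat) w mv : computable K -> computable L ->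
  computableF (fun v => instrF (K v) (jump (Action w mv (L v)))).
Proof.
move=> cK cL; have cA := computableF_action w mv cL; rewrite /instrF /branchF /=.
apply: computableF_Or; first exact: computableF_const.
apply: computableF_Or; first exact/computableF_neg_mark/computable_label.
apply: computableF_And; first exact: computableF_const.
by apply: computableF_And; apply: computableF_Or => //; apply: computableF_const.
Qed.

Lemma computable_inputF : computable1 (fun m => formula_code (inputF m)).
Proof.
pose j (v : 2.-tuple nat) := tnth v ord0.
apply: (@computable_rec1 (formula_code topF) (fun v => CodeSeq.code
  [:: 5; tnth v ord_max; formula_code (instrF (input_pc (j v)) (input_instr (j v)))])) => //.
apply: computable_code3; first exact: computable_proj.
have cj : computable j by apply: computable_proj.
by apply: computableF_jump; apply: computable_succ; apply: computable_double => //;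
  apply: computable_succ.
Qed.

Lemma computable_runF : exists f : recf 1, forall prog,
  let e := formula_code (machineF prog) in sem f [tuple e] (formula_code (runF prog e.*2)).
Proof.
suff [f fP] : computable1 (fun e => CodeSeq.code [:: 7; 0; CodeSeq.code [:: 7; 1;
    CodeSeq.code [:: 7; 2; CodeSeq.code [:: 8; 3;
      CodeSeq.code [:: 5; e; formula_code (input_phaseF e.*2)]]]]]).
  by exists f => prog e; apply: fP.
do 4!(apply: computable_code3; first exact: computable_const).
apply: computable_code3; first exact: computable_proj.
have c2 : computable (fun v : 1.-tuple nat => (thead v).*2).
  by apply: computable_double; apply: computable_proj.
apply: computableF_And; first exact: computable_comp1 computable_inputF c2.
apply: computableF_jump; last exact: computable_const.
by apply: computable_succ; apply: computable_double.
Qed.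

(** * Undecidability *)

(* The formula of the run of f on this very formula. *)
Lemma diagonal_formula (f : recf 1) : exists phi : tau_formula, E3A_sentence phi /\
  (sem f [tuple formula_code phi] 1 -> ~ satisfiable phi) /\
  (sem f [tuple formula_code phi] 0 -> finitely_satisfiable phi).
Proof.
have [h hP] := computable_runF; pose decider := Comp f (fun _ : 'I_1 => h).
pose prog := test_program (com_of_recf decider [tuple 0] 1 2).
pose e := formula_code (machineF prog); exists (runF prog e.*2).
split; first exact: runF_E3A.
have input k : [tuple of map (update (fun=> 0) 0 k.*2./2) [tuple 0]] = [tuple k].
  by apply: val_inj; rewrite /= update_same doubleK.
have runs r : sem f [tuple formula_code (runF prog e.*2)] r ->
    exists2 k, run (code prog e.*2) start k &
    node_label k = Some (if r == 0 then halt_pc prog else forbidden_pc prog).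
  move=> fr; have [//|//||g [ex <- _]] := com_of_recf_implements (f := decider)
      (args := [tuple 0]) (out := 1) (fresh := 2) (g := update (fun=> 0) 0 e.*2./2) (r := r).
    by exists [tuple formula_code (runF prog e.*2)] => // i; rewrite (ord1 i) input; apply: hP.
  exact: test_program_run ex.
split=> /runs[k start_k]; first exact: forbidden_unsatisfiable.
exact: halting_finitely_satisfiable.
Qed.

Lemma satisfiability_inseparable (P : tau_formula -> Prop) :
  (forall phi, P phi -> satisfiable phi) -> (forall phi, finitely_satisfiable phi -> P phi) ->
  ~ decidable_problem formula_code (@E3A_sentence tau_bin_un) P.
Proof.
move=> Psat satP [f fP]; have [phi [E3A_phi [f1 f0]]] := diagonal_formula f.
by case: (fP phi E3A_phi) => -[Pphi]; [move=> /f1; apply; apply: Psat|move=> /f0/satP].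
Qed.

Theorem theorem22 :
  ~ decidable_problem formula_code (@E3A_sentence tau_bin_un)
      (@satisfiable tau_bin_un) /\
  ~ decidable_problem formula_code (@E3A_sentence tau_bin_un)
      (@finitely_satisfiable tau_bin_un).
Proof.
have fin_sat phi : @finitely_satisfiable tau_bin_un phi -> satisfiable phi.
  by move=> [M [_ Mphi]]; exists M.
by split; apply: satisfiability_inseparable.
Qed.
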